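(* Fix a positive integer $d$. For a constant positive integer $r$, let $f_r(u,G,\mathbf{x})$ be an $r$-local independence function and let $\alpha=\alpha(f_r)$. For every $\gamma\in[\alpha^2,\alpha]$ and $\epsilon>0$, and for every sufficiently large $n$ (with $nd$ even), there exists a joint distribution of random vectors $(\mathbf{X},\mathbf{Y})\in[0,1]^n\times[0,1]^n$, each of $\mathbf{X}$ and $\mathbf{Y}$ having the uniform distribution on $[0,1]^n$ as its marginal, such that, with $(\mathbf{X},\mathbf{Y})$ drawn independently of $\mathbb{G}_d(n)$, $$\mathbb{P}_{\mathbb{G}_d(n),(\mathbf{X},\mathbf{Y})}\Big(\big|I_{\mathbb{G}_d(n)}(f_r,\mathbf{X})\cap I_{\mathbb{G}_d(n)}(f_r,\mathbf{Y})\big|\notin[(\gamma-\epsilon)n,(\gamma+\epsilon)n]\Big)\le\epsilon .$$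
   Context: All graphs are simple and undirected. For a positive integer $d$ and $n$ with $nd$ even, $\mathbb{G}_d(n)$ is a graph chosen uniformly at random among all $d$-regular graphs on vertex set $[n]=\{1,\dots,n\}$. For a graph $G$, $B_G(u,r)$ is the subgraph of $G$ induced by the vertices at distance at most $r$ from $u$. A decision function is a measurable function $f=f(u,G,\mathbf{x})\in\{0,1\}$, where $G$ is a graph on vertex set $[n]$ for some positive integer $n$, $u\in[n]$, and $\mathbf{x}\in[0,1]^N$ for some $N\ge n$. It is an independence function if for every graph $G$, every sequence $\mathbf{x}$ and every edge $(u,v)\in E(G)$, $f(u,G,\mathbf{x})=0$ or $f(v,G,\mathbf{x})=0$ (or both). Put $I_G(f,\mathbf{x})=\{u\in[n]: f(u,G,\mathbf{x})=1\}$. Given graphs $G_1,G_2$ on $[n_1],[n_2]$ and $u_1\in[n_1]$, $u_2\in[n_2]$, a map $\pi:[n_1]\to[n_2]$ is an $r$-local isomorphism mapping $u_1$ to $u_2$ if $\pi(u_1)=u_2$ and $\pi$ restricts to a graph isomorphism from $B_{G_1}(u_1,r)$ to $B_{G_2}(u_2,r)$. Sequences $x^{(1)}\in[0,1]^{N_1}$, $x^{(2)}\in[0,1]^{N_2}$ are then $r$-locally equivalent if $x^{(1)}_v=x^{(2)}_{\pi(v)}$ for every $v\in B_{G_1}(u_1,r)$. A decision function $f$ is $r$-local if $f(u_1,G_1,x^{(1)})=f(u_2,G_2,x^{(2)})$ for all $G_1,G_2,u_1,u_2$, every $r$-local isomorphism $\pi$ mapping $u_1$ to $u_2$, and all $r$-locally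 equivalent $x^{(1)},x^{(2)}$. $\mathbb{T}_{d,r}$ is the rooted tree of depth $r$ in which the root has $d$ children and each non-root vertex at distance less than $r$ from the root has $d-1$ children; its vertex set is taken to be $[n_{d,r}]$, where $n_{d,r}$ is its number of vertices, with root $1$. For an $r$-local function $f_r$ and $\mathbf{x}\in[0,1]^n$ with $n\ge n_{d,r}$, put $f_r(\mathbf{x})=f_r(1,\mathbb{T}_{d,r},\mathbf{x})$, and let $\alpha(f_r)=\mathbb{E}_{\mathbf{X}}[f_r(\mathbf{X})]$ with $\mathbf{X}$ uniform on $[0,1]^n$ (independent of the choice of $n\ge n_{d,r}$). *)

(* Defs.v *)
From HB Require Import structures.
From mathcomp Require Import all_boot all_order all_algebra.
From mathcomp Require Import all_classical all_reals all_analysis.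
From mathcomp Require Import measurable_realfun.

Set Implicit Arguments.
Unset Strict Implicit.
Unset Printing Implicit Defensive.

Import Order.TTheory GRing.Theory Num.Theory.
Import numFieldNormedType.Exports.

Local Open Scope classical_set_scope.
Local Open Scope ring_scope.

Definition simple_rel n (e : {ffun 'I_n * 'I_n -> bool}) : bool :=
  [forall u, ~~ e (u, u)] && [forall u, forall v, e (u, v) == e (v, u)].

Record sgraph n := SGraph {
  edges : {ffun 'I_n * 'I_n -> bool};
  edges_simple : simple_rel edges }.

HB.instance Definition _ n := [isSub for @edges n].
HB.instance Definition _ n := [Finite of sgraph n by <:].

Definition adj n (G : sgraph n) : rel 'I_n := fun u v => edges G (u, v).

Lemma simple_of_rel n (e : rel 'I_n) :
  simple_rel [ffun p => (p.1 != p.2) && (e p.1 p.2 || e p.2 p.1)].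
Proof.
apply/andP; split; first by apply/forallP => u; rewrite ffunE/= eqxx.
by apply/forallP => u; apply/forallP => v; rewrite !ffunE/= (eq_sym u) orbC.
Qed.

Definition graph_of_rel n (e : rel 'I_n) : sgraph n := SGraph (simple_of_rel e).

Definition edgeless n : sgraph n := graph_of_rel (fun _ _ => false).

Definition regular d n (G : sgraph n) : bool :=
  [forall u, #|[set v | adj G u v]%SET| == d].

(* The vertices at distance at most [r] from [u], i.e. those reached from [u]
    by a walk of at most [r] edges. *)
Definition ball n (G : sgraph n) (u : 'I_n) (r : nat) : set 'I_n :=
  [set v | exists p : seq 'I_n,
    [/\ path (adj G) u p, last u p = v & (size p <= r)%N]].

Definition local_iso r n1 n2 (G1 : sgraph n1) (G2 : sgraph n2)
    (u1 : 'I_n1) (u2 : 'I_n2) (pi : 'I_n1 -> 'I_n2) : Prop :=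
  [/\ pi u1 = u2,
      set_bij (ball G1 u1 r) (ball G2 u2 r) pi
    & forall v w, ball G1 u1 r v -> ball G1 u1 r w ->
        adj G2 (pi v) (pi w) = adj G1 v w].

Definition I01 (R : realType) := {i01 R}.

Section unit_interval.
Variable R : realType.

HB.instance Definition _ := Choice.on (I01 R).
HB.instance Definition _ := isPointed.Build (I01 R) (0%:i01 : {i01 R}).

Definition I01_val (x : I01 R) : R := (x : {i01 R})%:num.

Definition I01_measurable : set (set (I01 R)) :=
  preimage_set_system setT I01_val measurable.

Let sI01 : sigma_algebra setT I01_measurable.
Proof. by apply: sigma_algebra_preimage; exact: sigma_algebra_measurable. Qed.

Let m0 : I01_measurable set0. Proof. by case: sI01. Qed.
Let mC A : I01_measurable A -> I01_measurable (~` A).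
Proof. by case: sI01 => _ + _ => /[apply]; rewrite setTD. Qed.
Let mU (F : (set (I01 R))^nat) :
  (forall i, I01_measurable (F i)) -> I01_measurable (\bigcup_i F i).
Proof. by case: sI01 => _ _; apply. Qed.

HB.instance Definition _ :=
  isMeasurable.Build default_measure_display (I01 R) m0 mC mU.

Lemma measurable_I01_val : measurable_fun setT I01_val.
Proof. by move=> _ A mA; exists A. Qed.

Let clamp_ge0 (x : R) : 0 <= Num.max 0 (Num.min 1 x).
Proof. by rewrite le_max lexx. Qed.
Let clamp_le1 (x : R) : Num.max 0 (Num.min 1 x) <= 1.
Proof. by rewrite ge_max ler01 ge_min lexx. Qed.

Definition clamp (x : measurableTypeR R) : I01 R :=
  Itv01 (clamp_ge0 x) (clamp_le1 x).

Lemma clampK (x : R) : 0 <= x <= 1 -> I01_val (clamp x) = x.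
Proof.
by move=> /andP[x0 x1]; rewrite [LHS]/= (min_idPr x1) (max_idPr x0).
Qed.

Let mclamp : measurable_fun setT clamp.
Proof.
move=> _ _ [A mA <-]; rewrite !setTI -comp_preimage.
rewrite -[X in measurable X]setTI.
suff: measurable_fun setT (I01_val \o clamp) by apply.
rewrite (_ : _ \o _ = cst 0 \max (cst 1 \min id))//.
by apply: measurable_maxr => //; exact: measurable_minr.
Qed.

HB.instance Definition _ := isMeasurableFun.Build _ _ _ _ clamp mclamp.

(* [clamp] is the identity on [0,1], which carries all the mass of
   [uniform_prob (@ltr01 R)]; see [uniform_I01E]. *)
Definition uniform_I01 : probability (I01 R) R :=
  distribution (uniform_prob (@ltr01 R)) clamp.

Lemma uniform_I01E (B : set R) : measurable B ->
  uniform_I01 (I01_val @^-1` B) = lebesgue_measure (B `&` `[0, 1]).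
Proof.
move=> mB; rewrite /uniform_I01 /distribution /pushforward.
rewrite /= /uniform_prob. rewrite integral_uniform_pdf.
set C := (_ @^-1` _).
have -> : C `&` `[0, 1] = B `&` `[0, 1].
  by apply/seteqP; split=> x [Cx] /= /[dup] x01; rewrite in_itv/= => x01';
    split=> //; move: Cx; rewrite /C /preimage /mkset (clampK x01').
have mI : measurable (B `&` `[0%R, 1%R]) by exact: measurableI.
rewrite (eq_integral (cst 1%E)).
  by rewrite integral_cst// mul1e.
move=> x; rewrite inE => -[_ /=]; rewrite in_itv/= => x01.
by rewrite /uniform_pdf x01 subr0 invr1.
Qed.

End unit_interval.

Section power_probability.
Context d (T : measurableType d) (R : realType) (P : probability T R).

Definition tcons n (x : T * n.-tuple T) : n.+1.-tuple T :=
  [the n.+1.-tuple T of x.1 :: x.2].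

Let mtcons n : measurable_fun setT (@tcons n).
Proof. exact: measurable_cons. Qed.

HB.instance Definition _ n := isMeasurableFun.Build _ _ _ _ (@tcons n) (@mtcons n).

(* The law of [n] independent draws from [P]; see [powerP_box]. *)
Fixpoint powerP n : probability (n.-tuple T) R :=
  match n with
  | 0 => dirac ([tuple] : 0.-tuple T)
  | m.+1 => distribution (P \x powerP m)%E (@tcons m)
  end.

Lemma powerP_box n (A : 'I_n -> set T) : (forall i, measurable (A i)) ->
  powerP n [set x | forall i, A i (tnth x i)] = (\prod_(i < n) P (A i))%E.
Proof.
elim: n A => [|n IH] A mA.
  by rewrite big_ord0 /= diracE mem_set// => -[].
have mbox :
    measurable [set x : n.-tuple T | forall i, A (lift ord0 i) (tnth x i)].
  rewrite (_ : mkset _ = \bigcap_(i in [set: 'I_n])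
      (fun x : n.-tuple T => tnth x i) @^-1` A (lift ord0 i)).
    apply: fin_bigcap_measurable => // i _.
    by rewrite -[X in measurable X]setTI; apply: measurable_tnth.
  by apply/seteqP; split=> x /= h i; [move=> _; exact: h|exact: h].
rewrite big_ord_recl -(IH (fun i => A (lift ord0 i)))//.
rewrite -product_measure1E// /distribution /pushforward/=.
congr (_ _); apply/seteqP; split=> -[x t] /=.
  move=> h; split; first exact: (h ord0).
  by move=> i; have := h (lift ord0 i); rewrite tnthS.
move=> [h0 h] i; case: (unliftP ord0 i) => [j ->|->]; last exact: h0.
by rewrite tnthS; exact: h.
Qed.

End power_probability.

Definition uniform_cube (R : realType) n : probability (n.-tuple (I01 R)) R :=
  powerP (uniform_I01 R) n.

HB.instance Definition _ n := isPointed.Build (sgraph n) (edgeless n).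
HB.instance Definition _ n :=
  @isMeasurable.Build default_measure_display (sgraph n) discrete_measurable
    discrete_measurable0 discrete_measurableC discrete_measurableU.

Section random_regular_graph.
Variables (R : realType) (d n : nat).

Let mregular : measurable [set G : sgraph n | regular d G]. Proof. by []. Qed.

(* If there is no [d]-regular graph on [n] vertices (the restricted counting
   measure cannot be normalized) this is the point mass at the edgeless graph. *)
Definition random_regular_graph : probability (sgraph n) R :=
  mnormalize (mrestr (@counting (sgraph n) R) mregular) (dirac (edgeless n)).

Lemma counting_finset (B : {set sgraph n}) :
  @counting (sgraph n) R [set` B] = #|B|%:R%:E.
Proof.
have finB : finite_set [set` B].
  by apply: (sub_finite_set (@subsetT _ _)); exact: finite_finset.
rewrite /counting asboolT//; congr (_%:R%:E).
rewrite cardE; apply/perm_size/uniq_perm; rewrite ?fset_uniq ?enum_uniq// => G.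
by rewrite in_fset_set// mem_enum; apply/idP/idP; rewrite inE.
Qed.

Lemma random_regular_graphE (A : {set sgraph n}) :
  (exists G : sgraph n, regular d G) ->
  random_regular_graph [set` A] =
    (#|[set G in A | regular d G]%SET|%:R /
     #|[set G : sgraph n | regular d G]%SET|%:R)%:E.
Proof.
move=> [G0 regG0].
have H (B : {set sgraph n}) : @mrestr _ _ R _ counting mregular [set` B] =
    #|[set G in B | regular d G]%SET|%:R%:E.
  rewrite /mrestr -counting_finset; congr counting.
  by apply/seteqP; split=> G /=; rewrite inE => /andP.
have HT : @mrestr _ _ R _ counting mregular setT =
    #|[set G : sgraph n | regular d G]%SET|%:R%:E.
  rewrite /mrestr -counting_finset; congr counting.
  by apply/seteqP; split=> G /=; rewrite inE => // -[].
rewrite /random_regular_graph /= /mnormalize/= HT orbF eqe pnatr_eq0 cards_eq0.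
rewrite ifF ?H//; apply/negbTE/set0Pn; exists G0.
by rewrite inE.
Qed.

End random_regular_graph.

(* [f n N u G x]; only the values with [n <= N] are meaningful. *)
Definition decision_fun (R : realType) :=
  forall n N : nat, 'I_n -> sgraph n -> N.-tuple (I01 R) -> bool.

Section decision_functions.
Variable R : realType.
Implicit Types f : decision_fun R.

Definition measurable_decision f : Prop :=
  forall n N (u : 'I_n) (G : sgraph n), (n <= N)%N ->
    measurable_fun setT (f n N u G).

Definition independence_fun f : Prop :=
  forall n N (G : sgraph n) (x : N.-tuple (I01 R)) (u v : 'I_n), (n <= N)%N ->
    adj G u v -> f n N u G x = false \/ f n N v G x = false.

Definition indep_set f n N (G : sgraph n) (x : N.-tuple (I01 R)) : {set 'I_n} :=
  [set u | f n N u G x]%SET.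

Definition local_equiv r n1 n2 N1 N2 (le1 : (n1 <= N1)%N) (le2 : (n2 <= N2)%N)
    (G1 : sgraph n1) (u1 : 'I_n1) (pi : 'I_n1 -> 'I_n2)
    (x1 : N1.-tuple (I01 R)) (x2 : N2.-tuple (I01 R)) : Prop :=
  forall v, ball G1 u1 r v ->
    tnth x1 (widen_ord le1 v) = tnth x2 (widen_ord le2 (pi v)).

Definition local_fun r f : Prop :=
  forall n1 n2 N1 N2 (le1 : (n1 <= N1)%N) (le2 : (n2 <= N2)%N)
    (G1 : sgraph n1) (G2 : sgraph n2) (u1 : 'I_n1) (u2 : 'I_n2)
    (pi : 'I_n1 -> 'I_n2) (x1 : N1.-tuple (I01 R)) (x2 : N2.-tuple (I01 R)),
    local_iso r G1 G2 u1 u2 pi -> local_equiv r le1 le2 G1 u1 pi x1 x2 ->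
    f n1 N1 u1 G1 x1 = f n2 N2 u2 G2 x2.

End decision_functions.

Section regular_tree.
Variables d r : nat.

Definition tree_size : nat := (\sum_(i < r) d * d.-1 ^ i)%N.+1.

(* Vertices are numbered from the root [0] in breadth-first order: the root has
   children [1..d], and vertex [i > 0] has the [d - 1] children
   [d + 1 + (i - 1) * (d - 1), ..., d + i * (d - 1)] as long as these are
   smaller than [tree_size]. *)
Definition tree_parent (j : nat) : nat :=
  if (j <= d)%N then 0%N else ((j - d.+1) %/ d.-1)%N.+1.

Definition regular_tree : sgraph tree_size :=
  graph_of_rel (fun i j => (0 < j)%N && (i == tree_parent j :> nat)).

End regular_tree.

(* The expectation does not depend on the length of the random vector for a
   local function; the minimal length [tree_size d r] is used. *)
Definition alpha (R : realType) (d r : nat) (f : decision_fun R) : R :=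
  fine 'E_(uniform_cube R (tree_size d r))
    [fun x => (f (tree_size d r) (tree_size d r) ord0 (regular_tree d r) x)%:R].

(* Main.v *)
(* Let X, V, W be independent uniform vectors and let Y_i be X_i if W_i < p and
   V_i otherwise. On the regular tree the probability that f selects the root for
   both X and Y is Lipschitz in p, and ranges from alpha^2 (X, Y independent) to
   alpha (X = Y), so some p gives the value gamma. In G_d(n) all but few vertices
   see the regular tree, so the expected size of the intersection is close to
   gamma n; vertices at distance more than 2r contribute independently, and
   Chebyshev's inequality gives the concentration.

   That G_d(n) is locally a tree follows from an edge switching that injects
   pairs (an edge xy joined by a short detour, a far away edge ab) into regular
   graphs with a marked short walk a, x, ..., y, b: there are O(n) such walks
   but about nd choices of ab, so the expected number of such xy is bounded. *)
Require Import Defs.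
From HB Require Import structures.
From mathcomp Require Import all_boot all_order all_algebra.
From mathcomp Require Import all_classical all_reals all_analysis.
From mathcomp Require Import zify ring lra measurable_realfun.

Set Implicit Arguments.
Unset Strict Implicit.
Unset Printing Implicit Defensive.

Import Order.TTheory GRing.Theory Num.Theory.
Import numFieldNormedType.Exports.

(** * Balls in finite graphs *)

(** The random graph and the labels are treated in succession. All but a small proportion of the
    regular graphs have at most n/K bad vertices. For each such graph, held fixed, Chebyshev is
    applied over the labels alone, and every bad vertex shifts the mean by at most one.

    A vertex is bad if its r-ball contains the first end of an edge whose ends are also joined by a
    walk of length at most 2r avoiding that edge. This notion suits both sides of the argument. It
    concerns single edges, so one switching per edge bounds its expected frequency. Its absence is
    also exactly what is needed to embed the tree: two non-backtracking walks of length at most r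
    from the vertex with the same end would produce such an edge, so the universal covering is
    injective up to depth r.

    Existence of regular graphs has to be proved as well: without it the law of the random graph is
    a default point mass, and ratios of cardinalities say nothing about it. *)

Lemma card_bigcup_le (I T : finType) (P : pred I) (F : I -> {set T}) :
  #|\bigcup_(i | P i) F i| <= \sum_(i | P i) #|F i|.
Proof.
elim/big_rec2: _ => [|i m A _ IH]; first by rewrite cards0.
by apply: leq_trans (leq_card_setU _ _) _; rewrite leq_add2l.
Qed.

Section finite_balls.
Variables (T : finType) (e : rel T).
Implicit Types (x y z : T) (k : nat).

(** A decidable counterpart of [ball], so that cardinalities make sense, and for an arbitrary
    relation, so that it also serves graphs with an edge deleted. *)
Definition dball k x : {set T} :=
  iter k (fun S : {set T} => S :|: [set v | [exists u in S, e u v]]) [set x].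

Lemma in_dballS k x v : (v \in dball k.+1 x) =
  (v \in dball k x) || [exists u in dball k x, e u v].
Proof. by rewrite {1}/dball iterS inE inE. Qed.

Lemma dballP k x v :
  reflect (exists p, [/\ path e x p, last x p = v & size p <= k]) (v \in dball k x).
Proof.
elim: k v => [|k IH] v.
  rewrite /dball /= inE; apply: (iffP eqP) => [->|[[|a p] [//= _ <-]]] //.
  by exists [::].
rewrite in_dballS; apply: (iffP orP).
  case=> [/IH[p [pp lp sp]]|/exists_inP[u /IH[p [pp lp sp]] euv]].
    by exists p; split=> //; exact: leqW.
  by exists (rcons p v); rewrite rcons_path pp lp euv last_rcons size_rcons.
move=> [p]; case/lastP: p => [|p w] [].
  by move=> _ <- _; left; apply/IH; exists [::].
rewrite rcons_path last_rcons size_rcons ltnS => /andP[pp ew] <- sp; right.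
by apply/exists_inP; exists (last x p) => //; apply/IH; exists p.
Qed.

Lemma dball_center k x : x \in dball k x.
Proof. by apply/dballP; exists [::]. Qed.

Lemma dball_edge x y : e x y -> y \in dball 1 x.
Proof. by move=> xy; apply/dballP; exists [:: y]; rewrite /= xy. Qed.

Lemma dball_trans j k x y z :
  y \in dball j x -> z \in dball k y -> z \in dball (j + k) x.
Proof.
move=> /dballP[p [pp lp sp]] /dballP[q [pq lq sq]]; apply/dballP.
exists (p ++ q); rewrite cat_path pp lp pq last_cat lp lq size_cat.
by split=> //; exact: leq_add.
Qed.

Lemma dball_mono j k x : j <= k -> dball j x \subset dball k x.
Proof.
move=> jk; apply/fintype.subsetP => v /dballP[p [pp lp sp]]; apply/dballP.
by exists p; split=> //; exact: leq_trans sp jk.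
Qed.

Lemma dball_sym k x y : symmetric e -> (y \in dball k x) = (x \in dball k y).
Proof.
move=> se; suff H u v : u \in dball k v -> v \in dball k u.
  by apply/idP/idP; apply: H.
move=> /dballP[p [pp <- sp]]; apply/dballP; exists (rev (belast v p)).
rewrite size_rev size_belast; split=> //.
  by rewrite rev_path; under eq_path => a b do rewrite se.
case: p pp sp => //= a p _ _; by rewrite rev_cons last_rcons.
Qed.

Lemma card_dball_le d k x :
  (forall v, #|[set w | e v w]| <= d) -> #|dball k x| <= d.+1 ^ k.
Proof.
move=> dege; elim: k => [|k IH]; first by rewrite /dball /= cards1.
rewrite /dball iterS -/(dball k x).
apply: (@leq_trans (d.+1 * #|dball k x|)); last by rewrite expnS leq_pmul2l.
rewrite mulSn; apply: leq_trans (leq_card_setU _ _) _; rewrite leq_add2l.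
have -> : [set v | [exists u in dball k x, e u v]] =
    \bigcup_(u in dball k x) [set w | e u w].
  apply/setP => v; rewrite inE; apply/exists_inP/bigcupP => -[u uB];
    by rewrite ?inE => euv; exists u; rewrite ?inE.
apply: leq_trans (card_bigcup_le _ _) _.
by rewrite mulnC -sum_nat_const; exact: leq_sum.
Qed.

End finite_balls.

Arguments dball : simpl never.

Lemma dball_sub (T : finType) (e e' : rel T) k x :
  (forall u v, e u v -> e' u v) -> dball e k x \subset dball e' k x.
Proof.
move=> ee'; apply/fintype.subsetP => v /dballP[p [pp lp sp]]; apply/dballP.
by exists p; split=> //; exact: sub_path pp.
Qed.

(** * Edge switching in regular graphs *)

Lemma adj_sym n (G : sgraph n) : symmetric (adj G).
Proof.
case: G => e /= s u v; rewrite /adj /=.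
by move: s => /andP[_ /forallP/(_ u)/forallP/(_ v)/eqP].
Qed.

Lemma adj_irr n (G : sgraph n) u : adj G u u = false.
Proof.
case: G => e /= s; rewrite /adj /=.
by move: s => /andP[/forallP/(_ u)/negbTE].
Qed.

Lemma sgraph_eqP n (G H : sgraph n) : adj G =2 adj H -> G = H.
Proof. by move=> GH; apply/val_inj/ffunP => -[u v]; exact: GH. Qed.

Lemma adj_graph_of_rel n (e : rel 'I_n) u v :
  adj (graph_of_rel e) u v = (u != v) && (e u v || e v u).
Proof. by rewrite /adj ffunE. Qed.

Section switching.
Variable n : nat.
Implicit Types (G : sgraph n) (x y a b u v : 'I_n).

Definition switch_pairs x y a b u v : bool :=
  [|| (u, v) == (x, y), (u, v) == (a, b), (u, v) == (x, a) | (u, v) == (y, b)].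

(* Exchanges the edges xy, ab for xa, yb. Taking the symmetric difference with
   {xy, ab, xa, yb} makes the operation an involution for fixed x, y, a, b. *)
Definition switch x y a b G : sgraph n :=
  graph_of_rel (fun u v => adj G u v (+)
    (switch_pairs x y a b u v || switch_pairs x y a b v u)).

Lemma adj_switch x y a b G u v : u != v ->
  adj (switch x y a b G) u v = adj G u v (+)
    (switch_pairs x y a b u v || switch_pairs x y a b v u).
Proof.
by move=> uv; rewrite adj_graph_of_rel uv/= (adj_sym G v) (orbC (_ v u)) orbb.
Qed.

Lemma switchK x y a b : involutive (switch x y a b).
Proof.
move=> G; apply/sgraph_eqP => u v; have [->|uv] := eqVneq u v.
  by rewrite !adj_irr.
by rewrite !adj_switch// addbK.
Qed.

Lemma card_exchange (T : finType) (N N' : {set T}) p q : p != q -> p \in N ->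
  q \notin N -> (forall w, (w \in N') = (w \in N) (+) ((w == p) || (w == q))) ->
  #|N'| = #|N|.
Proof.
move=> pq pN qN H; have -> : N' = q |: (N :\ p).
  apply/setP => w; rewrite H !inE; have [->|wp] := eqVneq w p.
    by rewrite pN (negbTE pq).
  by have [->|//] := eqVneq w q; rewrite /= ?(negbTE qN)// addbF.
by rewrite cardsU1 !inE (negbTE qN) andbF [RHS](cardsD1 p) pN.
Qed.

Lemma switch_regular d x y a b G : uniq [:: x; y; a; b] ->
  adj G x y -> adj G a b -> ~~ adj G x a -> ~~ adj G y b ->
  regular d G -> regular d (switch x y a b G).
Proof.
rewrite /= !inE !negb_or => /and4P[/and3P[xy xa xb] /andP[ya yb] ab _].
move=> exy eab nxa nyb /forallP reg; apply/forallP => v.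
rewrite -(eqP (reg v)).
(* Each of the four vertices trades one neighbour p for another q: x trades y for a, y trades x for
   b, a trades b for x, and b trades a for y. *)
have H p q : p != q -> q != v -> adj G v p -> ~~ adj G v q ->
    (forall w, (switch_pairs x y a b v w || switch_pairs x y a b w v) =
       (w == p) || (w == q)) ->
    #|[set w | adj (switch x y a b G) v w]| == #|[set w | adj G v w]|.
  move=> pq qv evp nvq Hw; apply/eqP/(card_exchange pq); rewrite ?inE//.
  move=> w; rewrite !inE; have [->|wv] := eqVneq w v; last first.
    by rewrite adj_switch ?Hw// eq_sym.
  rewrite !adj_irr [v == q]eq_sym (negbTE qv) orbF.
  by have [vp|//] := eqVneq v p; rewrite -vp adj_irr in evp.
have nn := (negbTE xy, negbTE xa, negbTE xb, negbTE ya, negbTE yb, negbTE ab).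
have nn' : ((y == x) = false) * ((a == x) = false) * ((b == x) = false) *
    ((a == y) = false) * ((b == y) = false) * ((b == a) = false).
  by do 5?split; rewrite eq_sym nn.
have E := (xpair_eqE, nn, nn', eqxx, andbF, orbF, andbT).
have [?|vx] := eqVneq v x.
  by subst v; apply: (H y a); rewrite ?E// => w; rewrite /switch_pairs !E.
have [?|vy] := eqVneq v y.
  by subst v; apply: (H x b); rewrite ?E// 1?adj_sym// => w; rewrite /switch_pairs !E orbC.
have [?|va] := eqVneq v a.
  subst v; apply: (H b x); rewrite ?E// 1?(adj_sym G a)// => w.
  by rewrite /switch_pairs !E.
have [?|vb] := eqVneq v b.
  subst v; apply: (H a y); rewrite ?E// 1?(adj_sym G b)// => w.
  by rewrite /switch_pairs !E.
apply/eqP; congr #|pred_of_set _|; apply/setP => w; rewrite !inE.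
have [->|wv] := eqVneq v w; first by rewrite !adj_irr.
rewrite adj_switch// /switch_pairs !xpair_eqE.
by rewrite (negbTE vx) (negbTE vy) (negbTE va) (negbTE vb) !andbF !orbF addbF.
Qed.

End switching.

Definition del_edge (T : eqType) (e : rel T) x y : rel T :=
  fun u v => [&& e u v, (u, v) != (x, y) & (u, v) != (y, x)].

(** Says that the edge lies on a cycle of length at most L + 1, without speaking of cycles. Edges
    are ordered pairs here. *)
Definition bad_edge n (G : sgraph n) L (p : 'I_n * 'I_n) : bool :=
  adj G p.1 p.2 && (p.2 \in dball (del_edge (adj G) p.1 p.2) L p.1).

Lemma regularP d n (G : sgraph n) u :
  regular d G -> #|[set v | adj G u v]| = d.
Proof. by move=> /forallP/(_ u)/eqP. Qed.

Lemma card_dball_regular d n (G : sgraph n) k u :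
  regular d G -> #|dball (adj G) k u| <= d.+1 ^ k.
Proof. by move=> reg; apply: card_dball_le => v; rewrite (regularP v reg). Qed.

(** The detour stays within distance L of x, hence away from a and b, and it avoids xy by
    definition; so the switching leaves all its edges in place. The 3 in the radius excludes an edge
    yb, which would give the walk x, y, b, a. *)
Lemma switch_bad_edge n (G : sgraph n) L x y a b :
  bad_edge G L (x, y) -> adj G a b -> a \notin dball (adj G) L.+3 x ->
  [/\ uniq [:: x; y; a; b], ~~ adj G x a, ~~ adj G y b &
      [/\ y \in dball (adj (switch x y a b G)) L x,
          adj (switch x y a b G) x a & adj (switch x y a b G) y b]].
Proof.
move=> /andP[/= xy yL] ab aF.
have bF : b \notin dball (adj G) L.+2 x.
  apply: contra aF => bB; rewrite -[L.+3]addn1; apply: dball_trans bB _.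
  by apply: dball_edge; rewrite adj_sym.
have near k u : k <= L.+2 -> u \in dball (adj G) k x -> (u != a) && (u != b).
  move=> kL uB; apply/andP; split; [move: aF|move: bF]; apply: contra => /eqP <-.
    by apply: (fintype.subsetP (dball_mono _ _ _)) uB; exact: leqW.
  exact: (fintype.subsetP (dball_mono _ _ _)) uB.
have /andP[xa xb] : (x != a) && (x != b) by exact: (near 0%N _ _ (dball_center _ _ _)).
have /andP[ya yb] : (y != a) && (y != b) by apply: (near 1%N) => //; exact: dball_edge.
have nxy : x != y by apply: contraTneq xy => ->; rewrite adj_irr.
have nab : a != b by apply: contraTneq ab => ->; rewrite adj_irr.
have nxa : ~~ adj G x a.
  apply: contra aF => /(@dball_edge _ _ _ _); apply/fintype.subsetP.
  exact: dball_mono.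
have nyb : ~~ adj G y b.
  apply: contra aF => eyb.
  have /fintype.subsetP := @dball_mono _ (adj G) 3 L.+3 x isT; apply.
  apply: (@dball_trans _ _ 1 2 _ y); first exact: dball_edge.
  apply: (@dball_trans _ _ 1 1 _ b); first exact: dball_edge.
  by apply: dball_edge; rewrite adj_sym.
split=> //.
  by rewrite /= !inE !negb_or nxy xa xb ya yb nab.
split; last 2 first.
- by rewrite adj_switch// (negbTE nxa) /switch_pairs !eqxx !orbT.
- by rewrite adj_switch// (negbTE nyb) /switch_pairs !eqxx !orbT.
have sub k : k <= L -> dball (del_edge (adj G) x y) k x \subset
    dball (adj (switch x y a b G)) k x.
  elim: k => // k IH kL; apply/fintype.subsetP => v.
  have delsub u w : del_edge (adj G) x y u w -> adj G u w by case/and3P.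
  have nearD j u : j <= L.+2 -> u \in dball (del_edge (adj G) x y) j x ->
      (u != a) && (u != b).
    by move=> jL uD; apply: (near j) => //; exact: (fintype.subsetP (dball_sub _ _ delsub)) uD.
  have [vD|] := boolP (v \in dball (del_edge (adj G) x y) k x).
    move=> _; apply: (fintype.subsetP (dball_mono _ _ (leqnSn k))).
    by apply: (fintype.subsetP (IH (ltnW kL))).
  move=> nvD vD; have /exists_inP[u uD /and3P[uv uvxy uvyx]] :
      [exists u in dball (del_edge (adj G) x y) k x, del_edge (adj G) x y u v].
    by move: vD; rewrite in_dballS (negbTE nvD).
  rewrite -[k.+1]addn1; apply: (dball_trans (y := u)).
    by apply: (fintype.subsetP (IH (ltnW kL))).
  apply: dball_edge; rewrite adj_switch; last first.
    by apply: contraTneq uv => ->; rewrite adj_irr.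
  have kL2 : k < L.+2 by exact: leq_trans kL (leqW (leqnSn L)).
  have /andP[ua ub] : (u != a) && (u != b) by exact: (nearD k u (ltnW kL2) uD).
  have /andP[va vb] : (v != a) && (v != b) by exact: (nearD k.+1 v kL2 vD).
  move: uvxy uvyx; rewrite uv /switch_pairs !xpair_eqE.
  rewrite (negbTE ua) (negbTE ub) (negbTE va) (negbTE vb) !andbF !orbF.
  by rewrite [(v == x) && _]andbC => /negbTE -> /negbTE ->.
exact: (fintype.subsetP (sub L (leqnn L))).
Qed.

Lemma card_adj_regular d n (G : sgraph n) (A : {set 'I_n}) : regular d G ->
  #|[set q : 'I_n * 'I_n | adj G q.1 q.2 & q.1 \in A]| = #|A| * d.
Proof.
move=> reg; rewrite -sum1dep_card.
rewrite (eq_bigl (fun q : 'I_n * 'I_n => (q.1 \in A) && adj G q.1 q.2)); last first.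
  by move=> q; rewrite andbC.
rewrite -(pair_big_dep (mem A) (adj G) (fun _ _ => 1)) -sum_nat_const /=.
apply: eq_bigr => u _.
by rewrite -(regularP u reg) sum1dep_card.
Qed.

(** Double counting. Each bad edge leaves at least [n * d - d.+1 ^ L.+3 * d] ordered edges ab with a
    far from x. A marked walk is given by x, then y in its L-ball, then a neighbour of each. *)
Lemma sum_bad_edges d n L :
  (\sum_(G : sgraph n | regular d G) #|[set p | bad_edge G L p]|) *
    (n * d - d.+1 ^ L.+3 * d) <=
  #|[set G : sgraph n | regular d G]| * (n * d.+1 ^ L * (d * d)).
Proof.
pose far (G : sgraph n) (p q : 'I_n * 'I_n) :=
  adj G q.1 q.2 && (q.1 \notin dball (adj G) L.+3 p.1).
pose tgt (G : sgraph n) (p q : 'I_n * 'I_n) :=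
  [&& p.2 \in dball (adj G) L p.1, adj G p.1 q.1 & adj G p.2 q.2].
apply: (@leq_trans (\sum_(G : sgraph n | regular d G)
    \sum_(p | bad_edge G L p) \sum_(q | far G p q) 1)).
  rewrite big_distrl; apply: leq_sum => G reg /=.
  rewrite -sum_nat_cond_const; apply: leq_sum => p _.
  rewrite sum1dep_card.
  have -> : [set q | far G p q] =
      [set q : 'I_n * 'I_n | adj G q.1 q.2 & q.1 \in ~: dball (adj G) L.+3 p.1].
    by apply/setP => q; rewrite [LHS]inE [RHS]inE finset.in_setC.
  rewrite (card_adj_regular _ reg) cardsCs finset.setCK card_ord mulnBl.
  by rewrite leq_sub2l// leq_mul2r (card_dball_regular _ _ reg) orbT.
apply: (@leq_trans (\sum_(G : sgraph n | regular d G)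
    \sum_p \sum_(q | tgt G p q) 1)); last first.
  have -> c : #|[set G : sgraph n | regular d G]| * c =
      \sum_(G : sgraph n | regular d G) c by rewrite sum_nat_cond_const.
  apply: leq_sum => G reg.
  apply: (@leq_trans (\sum_(x : 'I_n) \sum_(y in dball (adj G) L x) d * d)).
    rewrite [leqRHS]pair_big_dep/= [leqRHS]big_mkcond/=; apply: leq_sum => -[x y] _ /=.
    rewrite /tgt /=; case: ifPn => yB; last by rewrite big_pred0.
    rewrite -(pair_big (adj G x) (adj G y) (fun _ _ => 1))/=.
    under eq_bigr do rewrite sum1dep_card (regularP y reg).
    by rewrite sum_nat_cond_const (regularP x reg).
  rewrite -mulnA -[in leqRHS](card_ord n) -sum_nat_const; apply: leq_sum => x _.
  by rewrite sum_nat_const leq_mul// card_dball_regular.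
rewrite (eq_bigr (fun G => \sum_p \sum_q (bad_edge G L p && far G p q : nat))); last first.
  move=> G _; rewrite big_mkcond/=; apply: eq_bigr => p _.
  case: bad_edge; rewrite ?big1_eq//= big_mkcond/=; apply: eq_bigr => q _.
  by case: far.
rewrite [leqRHS](eq_bigr (fun G => \sum_p \sum_q (tgt G p q : nat))); last first.
  by move=> G _; apply: eq_bigr => p _; rewrite big_mkcond/=; apply: eq_bigr => q _; case: tgt.
(* The four vertices are summed outermost: once they are fixed, the switching is an involution on
   graphs, hence injective, and a comparison of two sets of graphs remains. *)
rewrite exchange_big [leqRHS]exchange_big /=; apply: leq_sum => -[x y] _.
rewrite exchange_big [leqRHS]exchange_big /=; apply: leq_sum => -[a b] _.
have S (A B : pred (sgraph n)) :
    \sum_(G | A G) (B G : nat) = #|[set G | A G && B G]|.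
  by rewrite -sum1dep_card big_mkcondr/=; apply: eq_bigr => G _; case: (B G).
rewrite !S.
rewrite -(card_imset _ (can_inj (switchK x y a b))).
apply/subset_leq_card/fintype.subsetP => _ /imsetP[G + ->]; rewrite !inE.
move=> /andP[reg /andP[bad /andP[/= ab aF]]].
have [U nxa nyb [yB xa yb]] := switch_bad_edge bad ab aF.
have /andP[/= xy _] := bad.
by rewrite switch_regular// /tgt/= yB xa yb.
Qed.

(** The length r + r is that of a walk through u between two vertices of its r-ball. *)
Definition bad_vertices n (G : sgraph n) r : {set 'I_n} :=
  [set u | [exists p, (p.1 \in dball (adj G) r u) && bad_edge G (r + r) p]].

Lemma card_bad_vertices d n (G : sgraph n) r : regular d G ->
  #|bad_vertices G r| <= #|[set p | bad_edge G (r + r) p]| * d.+1 ^ r.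
Proof.
move=> reg; rewrite -sum_nat_const.
apply: (@leq_trans #|\bigcup_(p in [set p | bad_edge G (r + r) p])
                       dball (adj G) r p.1|).
  apply/subset_leq_card/fintype.subsetP => u; rewrite inE => /existsP[p].
  move=> /andP[pu bp]; apply/bigcupP; exists p; first by rewrite inE.
  by rewrite dball_sym//; exact: adj_sym.
apply: leq_trans (card_bigcup_le _ _) _.
by apply: leq_sum => p _; exact: card_dball_regular.
Qed.

Lemma few_bad_vertices d r K : 0 < d -> exists n0, forall n, n0 <= n ->
  #|[set G : sgraph n | regular d G & n < K * #|bad_vertices G r|]| * K <=
  #|[set G : sgraph n | regular d G]|.
Proof.
move=> d0; pose c1 := d.+1 ^ (r + r).+3 * d.
pose c2 := d.+1 ^ (r + r) * (d * d); pose C := (c2 * 2) * d.+1 ^ r.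
have C0 : 0 < C by rewrite /C /c2 !muln_gt0 d0 !expn_gt0.
(* The term [c1 * 2] gives [n <= (n * d - c1) * 2], so the far edges number at least n/2. The term
   [K * K * C] is what Markov's inequality, [#|B| * n <= K * (#|Reg| * C)], needs to end with
   [#|B| * K <= #|Reg|]. *)
exists (c1 * 2 + K * K * C).+1 => n nbig.
have n0 : 0 < n by exact: leq_trans nbig.
set Reg := [set G : sgraph n | regular d G].
pose b (G : sgraph n) := #|[set p | bad_edge G (r + r) p]|.
have S1 : \sum_(G : sgraph n | regular d G) b G <= #|Reg| * (c2 * 2).
  have := sum_bad_edges d n (r + r); rewrite -/c1 -/Reg.
  set S := (\sum_(G | _) _) => H.
  have {H} : S * (n * d - c1) <= #|Reg| * (n * c2).
    by apply: leq_trans H _; rewrite /c2 (mulnA n).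
  have H : n <= (n * d - c1) * 2.
    by have : n <= n * d; [rewrite leq_pmulr|lia].
  rewrite -/S => H2; rewrite -(leq_pmul2r n0).
  apply: (@leq_trans (S * ((n * d - c1) * 2))); first by rewrite leq_mul2l H orbT.
  by rewrite mulnA -mulnA mulnCA mulnA; move: H2; nia.
have S2 : \sum_(G : sgraph n | regular d G) #|bad_vertices G r| <= #|Reg| * C.
  apply: (@leq_trans ((\sum_(G : sgraph n | regular d G) b G) * d.+1 ^ r)).
    by rewrite big_distrl; apply: leq_sum => G /card_bad_vertices.
  by rewrite /C mulnA leq_mul2r S1 orbT.
set B := [set G : sgraph n | _ & _].
have S3 : #|B| * n <= K * (#|Reg| * C).
  apply: leq_trans (leq_mul (leqnn K) S2); rewrite -sum_nat_const big_distrr/=.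
  rewrite [leqRHS](bigID (mem B))/= -[leqLHS]addn0 leq_add//.
  rewrite [leqRHS](eq_bigl (mem B)); last first.
    by move=> G; rewrite !inE andbA andbb.
  by apply: leq_sum => G; rewrite inE => /andP[_ /ltnW].
have [->//|K0] := posnP K; first by rewrite muln0.
have KC0 : 0 < K * C by rewrite muln_gt0 K0.
rewrite -(leq_pmul2r KC0).
apply: (@leq_trans (#|B| * n)); first by rewrite -mulnA leq_mul2l; nia.
by apply: leq_trans S3 _; rewrite mulnCA.
Qed.

(** * Local structure of regular graphs *)

Section tree_indices.
Variable d : nat.
Hypothesis d_gt0 : 0 < d.
Local Notation parent := (tree_parent d).

Lemma tree_parent_lt j : 0 < j -> parent j < j.
Proof.
rewrite /tree_parent; case: (leqP j d) => // dj _.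
by have := leq_div (j - d.+1) d.-1; lia.
Qed.

Lemma tree_sizeS k : tree_size d k.+1 = (d + d.-1 * (tree_size d k).-1).+1.
Proof.
rewrite /tree_size big_ord_recl /= expn0 muln1 big_distrr/=.
by congr (_ + _).+1; apply: eq_bigr => i _; rewrite /bump /= expnS; lia.
Qed.

Lemma tree_parent_level k j : j < tree_size d k.+1 -> parent j < tree_size d k.
Proof.
rewrite tree_sizeS /tree_parent; case: (leqP j d) => // dj jS.
have d1 : 0 < d.-1 by case: (d.-1) jS => [|//]; lia.
rewrite -ltn_predRL ltn_divLR//.
by have : 0 < tree_size d k by []; nia.
Qed.

(** For d = 1 the tree has at most the vertices 0 and 1, whereas [tree_parent] and [sibling_rank]
    divide by d - 1 = 0 beyond index d. The disjunction rules this case out. *)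
Lemma tree_valid k j : j < tree_size d k -> (j <= d) || (1 < d).
Proof.
case: k => [|k]; first by rewrite /tree_size big_ord0; case: j.
rewrite tree_sizeS; case: (leqP j d) => //= dj.
by case: (d) d_gt0 dj => [|[|]] //=; lia.
Qed.

Definition sibling_rank j := if j <= d then j.-1 else (j - d.+1) %% d.-1.

Lemma sibling_inj i j : 0 < i -> 0 < j -> parent i = parent j ->
  sibling_rank i = sibling_rank j -> i = j.
Proof.
rewrite /tree_parent /sibling_rank; case: (leqP i d) => di; case: (leqP j d) => dj //.
- by lia.
- move=> _ _ [Eq] Em; have := divn_eq (i - d.+1) d.-1.
  by rewrite Eq Em -divn_eq; lia.
Qed.

Lemma sibling_rank_lt j : 0 < j -> (j <= d) || (1 < d) ->
  sibling_rank j < (if parent j == 0 then d else d.-1).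
Proof.
rewrite /sibling_rank /tree_parent; case: (leqP j d) => dj j0 /=; first by lia.
by move=> d1; rewrite ltn_pmod//; lia.
Qed.

Lemma tree_child p c k : c < (if p == 0 then d else d.-1) ->
  p < tree_size d k -> exists j,
  [/\ 0 < j, j < tree_size d k.+1, parent j = p & sibling_rank j = c].
Proof.
rewrite tree_sizeS; case: eqP => [->|/eqP p0] cd pk.
  by exists c.+1; rewrite /tree_parent /sibling_rank cd/=; split=> //; nia.
exists (d.+1 + p.-1 * d.-1 + c); rewrite /tree_parent /sibling_rank.
have -> : (d.+1 + p.-1 * d.-1 + c <= d) = false.
  by apply/negbTE; rewrite -ltnNge -addnA addSn ltnS leq_addr.
have -> : d.+1 + p.-1 * d.-1 + c - d.+1 = p.-1 * d.-1 + c.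
  by rewrite -addnA addKn.
have d1 : 0 < d.-1 by exact: leq_ltn_trans cd.
rewrite divnMDl// divn_small// modnMDl modn_small// addn0 prednK ?lt0n//.
split=> //; rewrite -addnA addSn ltnS ltn_add2l.
have ps : p.-1.+1 <= (tree_size d k).-1 by rewrite prednK ?lt0n// -ltnS.
apply: (@leq_trans (p.-1.+1 * d.-1)); first by rewrite mulSn addnC ltn_add2r.
by rewrite mulnC leq_mul2l ps orbT.
Qed.

End tree_indices.

Lemma del_edge_sym (T : eqType) (e : rel T) x y :
  symmetric e -> symmetric (del_edge e x y).
Proof.
move=> se u v; rewrite /del_edge se !xpair_eqE; congr (_ && _).
by rewrite andbC [(v == x) && _]andbC [(v == y) && _]andbC.
Qed.

(** * The covering map from the regular tree to the graph *)

Section covering.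
Variables (d n : nat) (G : sgraph n) (u : 'I_n).
Hypothesis d_gt0 : 0 < d.
Local Notation parent := (tree_parent d).
Local Notation N v := [set w | adj G v w].

(* The restriction to a ball of the universal covering of [G], based at [u]. *)
Fixpoint cover_fuel k j : 'I_n :=
  if k is k'.+1 then
    if j == 0 then u else
    let p := parent j in
    nth u (enum (if p == 0 then N (cover_fuel k' p)
                 else N (cover_fuel k' p) :\ cover_fuel k' (parent p)))
      (sibling_rank d j)
  else u.

Definition cover j := cover_fuel j.+1 j.

(** The vertices to which the children of p are sent. Leaving out the image of the parent of p makes
    the images along a branch a non-backtracking walk. *)
Definition fiber p : {set 'I_n} :=
  if p == 0 then N (cover p) else N (cover p) :\ cover (parent p).

Lemma cover_fuelE k k' j : j < k -> j < k' -> cover_fuel k j = cover_fuel k' j.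
Proof.
elim: k k' j => // k IH [//|k'] j; rewrite !ltnS => jk jk' /=.
case: eqP => // /eqP; rewrite -lt0n => j0.
have pj := tree_parent_lt d_gt0 j0.
case: eqP => [->|/eqP]; first by rewrite (IH k')//; lia.
rewrite -lt0n => p0; have := tree_parent_lt d_gt0 p0.
by move=> ppj; rewrite (IH k') ?(IH k' (parent (parent j)))//; lia.
Qed.

Lemma coverE j : 0 < j ->
  cover j = nth u (enum (fiber (parent j))) (sibling_rank d j).
Proof.
move=> j0; rewrite {1}/cover /= eqn0Ngt j0 /=; have pj := tree_parent_lt d_gt0 j0.
rewrite /fiber /cover; case: eqP => [->|/eqP].
  by rewrite (@cover_fuelE j 1 0).
rewrite -lt0n => p0; have ppj := tree_parent_lt d_gt0 p0.
rewrite (cover_fuelE pj (ltnSn _)).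
by rewrite (cover_fuelE (ltn_trans ppj pj) (ltnSn _)).
Qed.

Hypothesis reg : regular d G.

(** The point is that [nth] never returns its default. A non-root fiber has d - 1 elements only if
    the vertex removed is a neighbour, which is the same assertion one generation up; hence the
    strong induction. *)
Lemma cover_adj j : 0 < j -> (j <= d) || (1 < d) -> cover j \in fiber (parent j).
Proof.
have [m] := ubnP j; elim: m j => // m IH j; rewrite ltnS => jm j0 jd.
rewrite coverE// -mem_enum mem_nth// -cardE.
have rk := sibling_rank_lt d_gt0 j0 jd.
move: rk; rewrite /fiber; case: eqP => [_|/eqP p0]; first by rewrite (regularP _ reg).
suff nb : cover (parent (parent j)) \in N (cover (parent j)).
  have := cardsD1 (cover (parent (parent j))) (N (cover (parent j))).
  by rewrite (regularP _ reg) nb => /(congr1 predn) /= ->.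
have pj := tree_parent_lt d_gt0 j0.
have : cover (parent j) \in fiber (parent (parent j)).
  apply: IH; [lia|by rewrite lt0n|].
  by case/orP: jd => jd; rewrite ?jd ?orbT// (leq_trans (ltnW pj) jd).
rewrite inE adj_sym /fiber; case: ifP => _; first by rewrite inE.
by rewrite in_setD1 inE => /andP[].
Qed.

Lemma adj_cover_parent j : 0 < j -> (j <= d) || (1 < d) ->
  adj G (cover j) (cover (parent j)).
Proof.
move=> j0 jd; have := cover_adj j0 jd; rewrite /fiber adj_sym.
by case: ifP => _; rewrite !inE// => /andP[].
Qed.

Lemma card_fiber p : (p <= d) || (1 < d) ->
  #|fiber p| = if p == 0 then d else d.-1.
Proof.
move=> pd; rewrite /fiber; case: eqP => [_|/eqP p0]; first by rewrite (regularP _ reg).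
have nb : cover (parent p) \in N (cover p) by rewrite inE adj_cover_parent// lt0n.
have := cardsD1 (cover (parent p)) (N (cover p)).
by rewrite (regularP _ reg) nb => /(congr1 predn).
Qed.

Lemma cover_backtrack j : 0 < j -> 0 < parent j -> (j <= d) || (1 < d) ->
  cover j != cover (parent (parent j)).
Proof.
move=> j0 p0 jd; have := cover_adj j0 jd; rewrite /fiber eqn0Ngt p0/=.
by rewrite in_setD1 => /andP[].
Qed.

Lemma cover_sibling i j : 0 < i -> 0 < j -> (i <= d) || (1 < d) ->
  (j <= d) || (1 < d) -> parent i = parent j -> cover i = cover j -> i = j.
Proof.
move=> i0 j0 iv jv pij; rewrite !coverE// pij => /eqP.
have pv : (parent j <= d) || (1 < d).
  have pj := tree_parent_lt d_gt0 j0.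
  by case/orP: jv => jv; rewrite ?jv ?orbT// (leq_trans (ltnW pj) jv).
have := sibling_rank_lt d_gt0 i0 iv; have := sibling_rank_lt d_gt0 j0 jv.
rewrite pij -(card_fiber pv) => jr ir.
rewrite nth_uniq ?enum_uniq -?cardE// => /eqP.
exact: sibling_inj.
Qed.

Lemma cover_surj k v : v \in dball (adj G) k u ->
  exists2 j, j < tree_size d k & cover j = v.
Proof.
elim: k v => [|k IH] v.
  by rewrite /dball /= inE => /eqP ->; exists 0.
rewrite in_dballS => /orP[/IH[j jk <-]|].
  by exists j => //; apply: (leq_trans jk); rewrite /tree_size ltnS big_ord_recr leq_addr.
move=> /exists_inP[_ /IH[p pk <-] pv].
have := tree_valid d_gt0 pk => pd.
have H : v \in fiber p -> exists2 j, j < tree_size d k.+1 & cover j = v.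
  rewrite -mem_enum => vF; have := vF; rewrite -index_mem -cardE card_fiber// => idx.
  have [j [j0 jk pj rk]] := tree_child d_gt0 idx pk.
  by exists j => //; rewrite coverE// pj rk nth_index.
move: H; rewrite /fiber; case: ifP => p0; first by rewrite inE; apply.
(* The one neighbour of [cover p] that no child of p is sent to is the image of the parent of p,
   which has an index already. *)
rewrite !inE pv andbT; have [-> _|_] := eqVneq v (cover (parent p)).
  exists (parent p) => //; have : parent p < p by rewrite tree_parent_lt// lt0n p0.
  move=> pp; apply: (ltn_trans pp); apply: (leq_trans pk).
  by rewrite /tree_size ltnS big_ord_recr leq_addr.
by apply.
Qed.

(** Stated for any relation containing the images of the tree edges up to index i, so as to apply
    after an edge of the graph is deleted. *)
Lemma cover_up (e : rel 'I_n) k i : i < tree_size d k ->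
  (forall m, 0 < m <= i -> e (cover m) (cover (parent m))) ->
  u \in dball e k (cover i).
Proof.
elim: k i => [|k IH] i.
  rewrite /tree_size big_ord0; case: i => // _ _; exact: dball_center.
case: i => [|i] ik He.
  exact: (fintype.subsetP (dball_mono _ _ (leq0n _)) _ (dball_center _ _ _)).
rewrite -add1n; apply: (dball_trans (y := cover (parent i.+1))).
  by apply: dball_edge; apply: He; rewrite ltnS leqnn.
have pi : parent i.+1 < i.+1 by exact: tree_parent_lt.
apply: IH; first exact: tree_parent_level.
by move=> m /andP[m0 mi]; apply: He; rewrite m0/=; lia.
Qed.

(** Climb from [cover i] to u and descend to [cover j]: at most r steps each way, none of them along
    xy. *)
Lemma cover_detour r i j x y : i < tree_size d r -> j < tree_size d r ->
  (forall m, 0 < m -> (m <= i) || (m <= j) ->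
    ((cover m, cover (parent m)) != (x, y)) &&
    ((cover m, cover (parent m)) != (y, x))) ->
  cover j \in dball (del_edge (adj G) x y) (r + r) (cover i).
Proof.
move=> ir jr H; have se := del_edge_sym x y (adj_sym G).
have valid m : (m <= i) || (m <= j) -> (m <= d) || (1 < d).
  by move=> mij; apply: (tree_valid (k := r) d_gt0); lia.
have K m : 0 < m -> (m <= i) || (m <= j) ->
    del_edge (adj G) x y (cover m) (cover (parent m)).
  by move=> m0 mij; rewrite /del_edge H// adj_cover_parent// valid.
apply: (dball_trans (y := u)); last rewrite dball_sym//.
  by apply: cover_up => // m /andP[m0 mi]; rewrite K// mi.
by apply: cover_up => // m /andP[m0 mi]; rewrite K// mi orbT.
Qed.

Variable r : nat.
Hypothesis acyclic : forall x y, x \in dball (adj G) r u ->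
  ~~ bad_edge G (r + r) (x, y).

Lemma cover_in_dball i : i < tree_size d r -> cover i \in dball (adj G) r u.
Proof.
move=> ir; rewrite dball_sym; last exact: adj_sym.
apply: cover_up => // m /andP[m0 mi]; apply: adj_cover_parent => //.
by apply: (tree_valid (k := r) d_gt0); lia.
Qed.

(* If i is minimal with cover i = cover j for some j < i, then the tree walk
   from j to the parent of i closes up to a cycle with the edge from
   cover (parent i) to cover i. *)
Lemma cover_inj i j : i < tree_size d r -> j < tree_size d r ->
  cover i = cover j -> i = j.
Proof.
suff H k : k < tree_size d r -> forall l, l < k -> cover k != cover l.
  move=> ir jr ij; have [ji|ij'|//] := ltngtP i j.
    by have := H _ jr _ ji; rewrite ij eqxx.
  by have := H _ ir _ ij'; rewrite ij eqxx.
elim/ltn_ind: k => k IH kr l lk; apply/negP => /eqP kl.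
have inj a b : a < k -> b < k -> cover a = cover b -> a = b.
  move=> ak bk ab; have [ba|ba|//] := ltngtP a b.
    by have := IH _ bk (ltn_trans bk kr) _ ba; rewrite ab eqxx.
  by have := IH _ ak (ltn_trans ak kr) _ ba; rewrite ab eqxx.
have k0 : 0 < k by exact: leq_ltn_trans lk.
have kv := tree_valid d_gt0 kr.
have pk := tree_parent_lt d_gt0 k0.
have /negP := acyclic (cover (parent k)) (cover_in_dball (ltn_trans lk kr)).
apply; rewrite /bad_edge /= -{1}kl adj_cover_parent//=.
apply: cover_detour => [||m m0 mlk]; try exact: ltn_trans kr.
have mk : m < k by lia.
have pm := tree_parent_lt d_gt0 m0.
rewrite !xpair_eqE; apply/andP; split; apply/negP => /andP[/eqP E1 /eqP E2].
  have ml : m = l by apply: inj.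
  have pml : parent m = parent k by apply: inj => //; lia.
  have : k = m; last by lia.
  apply: cover_sibling => //; last by rewrite kl ml.
  by apply: (tree_valid (k := r) d_gt0); lia.
have mpk : m = parent k by apply: inj.
have pml : parent m = l by apply: inj => //; lia.
have := @cover_backtrack k k0; rewrite -mpk => /(_ m0 kv).
by rewrite pml kl eqxx.
Qed.

(** By injectivity, an edge between two images that is not the image of a tree edge differs from all
    edges of the tree walks through u. Those walks then form a detour and make the edge bad. *)
Lemma adj_cover i j : i < tree_size d r -> j < tree_size d r ->
  adj G (cover i) (cover j) =
  (i != j) && ((0 < j) && (i == parent j) || (0 < i) && (j == parent i)).
Proof.
move=> ir jr; have iv := tree_valid d_gt0 ir; have jv := tree_valid d_gt0 jr.
apply/idP/idP => [ij|/andP[_ /orP[/andP[j0 /eqP ->]|/andP[i0 /eqP ->]]]]; last 2 first.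
- by rewrite adj_sym adj_cover_parent.
- exact: adj_cover_parent.
have [E|nij /=] := eqVneq i j; first by rewrite E adj_irr in ij.
apply/negPn/negP; rewrite negb_or => /andP[nj ni].
have /negP := acyclic (cover j) (cover_in_dball ir).
apply; rewrite /bad_edge /= ij; apply: cover_detour => // m m0 mij.
have mr : m < tree_size d r by lia.
have pm := tree_parent_lt d_gt0 m0.
have pmr : parent m < tree_size d r by lia.
rewrite !xpair_eqE; apply/andP; split; apply/negP => /andP[/eqP E1 /eqP E2].
  have mi : m = i by apply: cover_inj.
  have mj : parent m = j by apply: cover_inj.
  by move: ni; rewrite -mi m0 mj eqxx.
have mi : m = j by apply: cover_inj.
have mj : parent m = i by apply: cover_inj.
by move: nj; rewrite -mi m0 mj eqxx.
Qed.

End covering.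

Lemma ballP n (G : sgraph n) u r v : Defs.ball G u r v <-> v \in dball (adj G) r u.
Proof. by split=> [h|/dballP//]; apply/dballP. Qed.

Lemma ball_regular_tree d r (i : 'I_(tree_size d r)) : 0 < d ->
  Defs.ball (regular_tree d r) ord0 r i.
Proof.
move=> d0; apply/ballP; rewrite dball_sym; last exact: adj_sym.
suff H k (j : 'I_(tree_size d r)) : j < tree_size d k ->
  ord0 \in dball (adj (regular_tree d r)) k j by exact: H.
elim: k j => [|k IH] j.
  rewrite /tree_size big_ord0 ltnS leqn0 => /eqP j0.
  have -> : j = ord0 by exact/val_inj.
  exact: dball_center.
have [->|j0 jk] := eqVneq j ord0.
  by move=> _; apply: (fintype.subsetP (dball_mono _ _ (leq0n _)) _ (dball_center _ _ _)).
have j0' : 0 < j by rewrite lt0n.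
have pj := tree_parent_lt d0 j0'.
pose p : 'I_(tree_size d r) := Ordinal (ltn_trans pj (ltn_ord j)).
rewrite -[k.+1]add1n; apply: (dball_trans (y := p)).
  apply: dball_edge; rewrite adj_graph_of_rel /= j0' eqxx orbT andbT.
  by apply/eqP => jp; move: (pj); rewrite -[tree_parent d j]/(val p) -jp ltnn.
by apply: IH; exact: tree_parent_level.
Qed.

(** Injectivity on all indices is recorded because it keeps the labels pulled back along phi
    independent. *)
Lemma regular_tree_local_iso d r n (G : sgraph n) u : 0 < d -> regular d G ->
  (forall x y, x \in dball (adj G) r u -> ~~ bad_edge G (r + r) (x, y)) ->
  exists2 phi : 'I_(tree_size d r) -> 'I_n,
    injective phi & local_iso r (regular_tree d r) G ord0 u phi.
Proof.
move=> d0 reg acyc; exists (fun i => cover d G u i) => [i j|].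
  by move=> /(cover_inj d0 reg acyc (ltn_ord i) (ltn_ord j)) /val_inj.
split=> //; last first.
  move=> i j _ _; rewrite (adj_cover d0 reg acyc)// adj_graph_of_rel.
  by rewrite -val_eqE.
split.
- by move=> i _; apply/ballP; apply: cover_in_dball.
- by move=> i j _ _ /(cover_inj d0 reg acyc (ltn_ord i) (ltn_ord j)) /val_inj.
- move=> v /ballP /(cover_surj d0 reg)[j jr <-].
  by exists (Ordinal jr) => //; exact: ball_regular_tree.
Qed.

(** * Existence of regular graphs *)

Lemma Cayley_graph_regular m (D : {set 'I_m.+1}) : 0%R \notin D ->
  (forall x, (- x)%R \in D = (x \in D)) ->
  regular #|D| (graph_of_rel (fun u v : 'I_m.+1 => (v - u)%R \in D)).
Proof.
move=> D0 DN; apply/forallP => u; apply/eqP.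
rewrite -(card_imset D (addrI u)); congr #|pred_of_set _|.
apply/setP => v; rewrite inE adj_graph_of_rel.
apply/andP/imsetP => [[_]|[x xD ->]].
  move=> uv; exists (v - u)%R; last by rewrite addrC subrK.
  by case/orP: uv => // uv; rewrite -DN opprB.
rewrite [X in (X - u)%R]addrC addrK xD; split=> //.
by rewrite -subr_eq0 opprD addrA subrr sub0r oppr_eq0; apply: contraNneq D0 => <-.
Qed.

(* The connection set of the circulant graph is {1, ..., d/2}, its opposite
   and, for odd d, the element n/2 of order two. *)
Lemma exists_regular d n : d < n -> ~~ odd (n * d) ->
  exists G : sgraph n, regular d G.
Proof.
case: n => // m dm nd.
suff [D [D0 DN <-]] : exists D : {set 'I_m.+1},
    [/\ 0%R \notin D, forall x, (- x)%R \in D = (x \in D) & #|D| = d].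
  by eexists; exact: Cayley_graph_regular D0 DN.
have valN (x : 'I_m.+1) : (- x)%R = (m.+1 - x) %% m.+1 :> nat by [].
have valN0 (x : 'I_m.+1) : 0 < x -> (- x)%R = m.+1 - x :> nat.
  by move=> x0; rewrite valN modn_small//; lia.
pose k := d./2.
have dk : d = odd d + k.*2 by rewrite odd_double_half.
pose A : {set 'I_m.+1} := [set x : 'I_m.+1 | 0 < x <= k].
have km : k <= m by lia.
have ik (i : 'I_k) : i.+1 < m.+1 by rewrite ltnS (leq_trans (ltn_ord i) km).
have cA : #|A| = k.
  have inj : injective (fun i : 'I_k => inord i.+1 : 'I_m.+1).
    move=> i j /(congr1 val); rewrite /= !inordK// => -[ij].
    exact/val_inj.
  rewrite -[RHS]card_ord -(card_imset _ inj) ; congr #|pred_of_set _|.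
  apply/setP => x; rewrite inE; apply/andP/imsetP => [[x0 xk]|[i _ ->]].
    have xk' : x.-1 < k by lia.
    by exists (Ordinal xk') => //; apply/val_inj; rewrite /= inordK prednK.
  by rewrite inordK// (ltn_ord i).
pose B : {set 'I_m.+1} := [set (- x)%R | x in A].
have inB x : (x \in B) = ((- x)%R \in A).
  by rewrite -[in LHS](opprK x) mem_imset//; exact: oppr_inj.
have cB : #|B| = k by rewrite card_imset//; exact: oppr_inj.
(* Elements of A are at most k, their opposites at least m + 1 - k, and 2k is at most d, hence less
   than m + 1. *)
have AB0 : A :&: B = finset.set0.
  apply/setP => x; rewrite !inE inB inE; apply/negP.
  by move=> /andP[/andP[x0 xk]]; rewrite valN0//; lia.
have cAB : #|A :|: B| = k.*2 by rewrite cardsU AB0 cards0 cA cB subn0 addnn.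
have N0 : 0%R \notin A :|: B by rewrite inE inB oppr0 !inE.
have NAB x : (- x)%R \in A :|: B = (x \in A :|: B).
  by rewrite !finset.in_setU !inB opprK orbC.
have [od|od] := boolP (odd d); last first.
  by exists (A :|: B); split=> //; rewrite cAB; lia.
have em : ~~ odd m.+1 by move: nd; rewrite oddM od andbT.
have [q mq] : exists q, m.+1 = q.*2.
  by exists m.+1./2; rewrite -[LHS]odd_double_half (negbTE em).
pose h : 'I_m.+1 := inord q.
have vh : h = q :> nat by rewrite inordK//; lia.
have vNh : (- h)%R = q :> nat by rewrite valN0 vh; lia.
have hN : (- h)%R = h by apply/val_inj; rewrite [RHS]vh.
exists (h |: (A :|: B)); split.
- rewrite finset.in_setU1 negb_or N0 andbT; apply/eqP => /(congr1 val) /=; lia.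
- by move=> x; rewrite !(finset.in_setU1, NAB) -[in RHS](inj_eq oppr_inj) hN.
- rewrite cardsU1 cAB finset.in_setU inB hN orbb inE vh; lia.
Qed.

(** * Powers of a probability *)

Local Open Scope classical_set_scope.
Local Open Scope ring_scope.

Definition law d d' (T : measurableType d) (T' : measurableType d')
    (R : realType) (P : probability T R) (f : T -> T')
    (mf : measurable_fun setT f) : probability T' R :=
  distribution P (mfun_Sub (mem_set mf)).

Lemma lawE d d' (T : measurableType d) (T' : measurableType d')
    (R : realType) (P : probability T R) (f : T -> T')
    (mf : measurable_fun setT f) A :
  law P mf A = P (f @^-1` A).
Proof. by []. Qed.

Section powers.
Context d (T : measurableType d) (R : realType).

Definition box n (A : 'I_n -> set T) : set (n.-tuple T) :=
  [set x | forall i, A i (tnth x i)].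

Lemma measurable_box n (A : 'I_n -> set T) :
  (forall i, measurable (A i)) -> measurable (box A).
Proof.
move=> mA; rewrite (_ : box A = \bigcap_(i in [set: 'I_n])
    (fun x : n.-tuple T => tnth x i) @^-1` A i).
  apply: fin_bigcap_measurable => // i _.
  by rewrite -[X in measurable X]setTI; apply: measurable_tnth.
by apply/seteqP; split=> x /= h i; [move=> _; exact: h|exact: h].
Qed.

Lemma powerP_boxE n (P : probability T R) (A : 'I_n -> set T) :
  (forall i, measurable (A i)) -> powerP P n (box A) = (\prod_(i < n) P (A i))%E.
Proof. exact: powerP_box. Qed.

Lemma tuple_measure_unique n (m1 m2 : {measure set (n.-tuple T) -> \bar R}) :
  (m1 setT < +oo)%E ->
  (forall A, (forall i, measurable (A i)) -> m1 (box A) = m2 (box A)) ->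
  forall X, measurable X -> m1 X = m2 X.
Proof.
move=> m1oo m12.
pose C := [set B : set (n.-tuple T) |
  exists2 A, (forall i, measurable (A i)) & B = box A].
have CT : C setT.
  by exists (fun=> setT) => //; apply/seteqP.
apply: (measure_unique C (fun=> setT)) => //.
- apply/seteqP; split.
    apply: smallest_sub; first exact: smallest_sigma_algebra.
    rewrite -bigcup_seq => B [i _] [A mA <-]; rewrite setTI.
    apply: sub_sigma_algebra; exists (fun j => if j == i then A else setT).
      by move=> j; case: ifP.
    apply/seteqP; split=> x /= H; first by move=> j; case: eqP => // ->.
    by have := H i; rewrite eqxx.
  apply: smallest_sub; first exact: sigma_algebra_measurable.
  by move=> _ [A mA ->]; exact: measurable_box.
- move=> _ _ [A mA ->] [B mB ->]; exists (fun i => A i `&` B i).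
    by move=> i; exact: measurableI.
  apply/seteqP; split=> x /=; first by move=> [HA HB] i; split.
  by move=> H; split=> i; case: (H i).
- by rewrite bigcup_const//; exists 0%N.
- by move=> _ [A mA ->]; exact: m12.
Qed.

Lemma powerP_unique n (P : probability T R) (Q : probability (n.-tuple T) R) :
  (forall A, (forall i, measurable (A i)) -> Q (box A) = (\prod_(i < n) P (A i))%E) ->
  forall X, measurable X -> Q X = powerP P n X.
Proof.
move=> QE; apply: (@tuple_measure_unique n Q (powerP P n)).
  by suff : (Q setT < +oo)%E by []; rewrite probability_setT ltry.
by move=> A mA; exact: etrans (QE A mA) (esym (powerP_boxE P mA)).
Qed.

Definition reindex m n (phi : 'I_m -> 'I_n) (x : n.-tuple T) : m.-tuple T :=
  [tuple tnth x (phi i) | i < m].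

Lemma measurable_reindex m n (phi : 'I_m -> 'I_n) :
  measurable_fun setT (reindex phi).
Proof.
apply/measurable_fun_tnthP => i.
rewrite (_ : _ \o _ = (@tnth n T)^~ (phi i)); first exact: measurable_tnth.
by apply/funext => x /=; rewrite tnth_mktuple.
Qed.

Lemma powerP_reindex (P : probability T R) m n (phi : 'I_m -> 'I_n) A :
  injective phi -> measurable A ->
  powerP P n (reindex phi @^-1` A) = powerP P m A.
Proof.
move=> inj mA; rewrite -(lawE _ (measurable_reindex phi)).
apply: powerP_unique => // {mA}A mA.
(* The constraint on coordinate i moves to coordinate [phi i]; coordinates outside the range of phi
   are left free and contribute a factor 1. *)
pose B j := if [pick i | phi i == j] is Some i then A i else setT.
have Bphi i : B (phi i) = A i.
  by rewrite /B; case: pickP => [k /eqP/inj ->|/(_ i)]; rewrite ?eqxx.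
have mB j : measurable (B j) by rewrite /B; case: pickP.
rewrite lawE (_ : _ @^-1` _ = box B); last first.
  apply/seteqP; split=> x /= H.
    move=> j; rewrite /B; case: pickP => // i /eqP <-.
    by have := H i; rewrite tnth_mktuple.
  by move=> i; rewrite tnth_mktuple -Bphi; exact: H.
rewrite [LHS]powerP_boxE// (bigID (mem (codom phi)))/= [X in (_ * X)%E]big1 ?mule1.
  rewrite -big_uniq/=; last by rewrite codomE map_inj_uniq// enum_uniq.
  by rewrite codomE big_map big_enum/=; apply: eq_bigr => i _; rewrite Bphi.
move=> j /codomP nj.
rewrite /B; case: pickP => [i /eqP ij|_]; last exact: probability_setT.
by case: nj; exists i.
Qed.

End powers.

Lemma measurable_map_tuple d d' (T : measurableType d) (T' : measurableType d')
    (h : T -> T') n : measurable_fun setT h ->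
  measurable_fun setT (map_tuple h : n.-tuple T -> n.-tuple T').
Proof.
move=> mh; apply/measurable_fun_tnthP => i.
rewrite (_ : _ \o _ = h \o (@tnth n T)^~ i).
  by apply: measurableT_comp => //; exact: measurable_tnth.
by apply/funext => x /=; rewrite tnth_map.
Qed.

Lemma powerP_map d d' (T : measurableType d) (T' : measurableType d')
    (R : realType) (P : probability T R) (P' : probability T' R) (h : T -> T')
    n (A : set (n.-tuple T')) : measurable_fun setT h ->
  (forall B, measurable B -> P (h @^-1` B) = P' B) -> measurable A ->
  powerP P n (map_tuple h @^-1` A) = powerP P' n A.
Proof.
move=> mh PP' mA; rewrite -(lawE _ (measurable_map_tuple (n := n) mh)).
apply: powerP_unique => // {mA}A mA.
rewrite lawE (_ : _ @^-1` _ = box (fun i => h @^-1` A i)); last first.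
  by apply/seteqP; split=> x /= H i; have := H i; rewrite tnth_map.
rewrite [LHS]powerP_boxE; first by apply: eq_bigr => i _; rewrite -PP'.
by move=> i; rewrite -[X in measurable X]setTI; exact: mh.
Qed.

Section independence.
Context d (T : measurableType d) (R : realType) (P : probability T R) (n : nat).
Variable S : pred 'I_n.

(** Splices two independent samples. The result has the original law, while events depending on
    coordinates inside S and outside S become events about different samples. *)
Definition merge (xy : n.-tuple T * n.-tuple T) : n.-tuple T :=
  [tuple if S i then tnth xy.1 i else tnth xy.2 i | i < n].

Lemma measurable_merge : measurable_fun setT merge.
Proof.
apply/measurable_fun_tnthP => i.
rewrite (_ : _ \o _ = fun xy => if S i then tnth xy.1 i else tnth xy.2 i).
  case: (S i).
    exact: (measurableT_comp (measurable_tnth i) measurable_fst).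
  exact: (measurableT_comp (measurable_tnth i) measurable_snd).
by apply/funext => x /=; rewrite tnth_mktuple.
Qed.

Lemma powerP_merge A : measurable A ->
  (powerP P n \x powerP P n)%E (merge @^-1` A) = powerP P n A.
Proof.
move=> mA.
rewrite -(lawE (powerP P n \x powerP P n)%E measurable_merge).
apply: powerP_unique => // {mA}A mA.
rewrite lawE (_ : _ @^-1` _ = box (fun i => if S i then A i else setT) `*`
                          box (fun i => if S i then setT else A i)); last first.
  apply/seteqP; split=> -[x y] /= H.
    by split=> i /=; have := H i; rewrite tnth_mktuple; case: ifP.
  by case: H => /= H1 H2 i; have := H1 i; have := H2 i; rewrite tnth_mktuple/=; case: ifP.
have mB1 i : measurable (if S i then A i else setT) by case: ifP.
have mB2 i : measurable (if S i then setT else A i) by case: ifP.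
transitivity (powerP P n (box (fun i => if S i then A i else setT)) *
              powerP P n (box (fun i => if S i then setT else A i)))%E.
  by apply: product_measure1E; exact: measurable_box.
rewrite !powerP_boxE//.
rewrite [in RHS](bigID S)/= [in X in (X * _)%E](bigID S)/=.
rewrite [in X in (_ * X)%E](bigID S)/=.
rewrite [X in (_ * X * _)%E]big1 ?mule1; last first.
  by move=> i /negbTE ->; exact: probability_setT.
rewrite [X in (_ * (X * _))%E]big1 ?mul1e; last first.
  by move=> i ->; exact: probability_setT.
by congr (_ * _)%E; apply: eq_bigr => i; [move=> ->|move=> /negbTE ->].
Qed.

(* Both events pull back along [merge] to a rectangle. *)
Lemma powerP_indep (A B : set (n.-tuple T)) : measurable A -> measurable B ->
  (forall x y, (forall i, S i -> tnth x i = tnth y i) -> A x -> A y) ->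
  (forall x y, (forall i, ~~ S i -> tnth x i = tnth y i) -> B x -> B y) ->
  powerP P n (A `&` B) = (powerP P n A * powerP P n B)%E.
Proof.
move=> mA mB AS BS; rewrite -powerP_merge; last exact: measurableI.
transitivity ((powerP P n \x powerP P n)%E (A `*` B)); last first.
  exact: product_measure1E.
congr (_ _).
apply/seteqP; split=> -[x y] /= [Ax Bx]; split.
- by apply: AS Ax => i Si; rewrite tnth_mktuple Si.
- by apply: BS Bx => i /negbTE Si; rewrite tnth_mktuple Si.
- by apply: AS Ax => i Si; rewrite tnth_mktuple Si.
- by apply: BS Bx => i /negbTE Si; rewrite tnth_mktuple Si.
Qed.

End independence.

(** * The interpolating coupling *)

Section independent_images.
Context d d' (T : measurableType d) (T' : measurableType d') (R : realType).
Variables (Q : probability T R) (P : probability T' R) (h1 h2 : T -> T').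
Hypotheses (mh1 : measurable_fun setT h1) (mh2 : measurable_fun setT h2).
Hypothesis h12 : forall B C, measurable B -> measurable C ->
  Q (h1 @^-1` B `&` h2 @^-1` C) = (P B * P C)%E.

(** Listing all h1-images and then all h2-images gives 2m independent coordinates, so independence
    of the two image vectors becomes independence of the two halves of one power. *)
Let cat_map m (z : m.-tuple T) : (m + m).-tuple T' :=
  [tuple of map_tuple h1 z ++ map_tuple h2 z].

Let measurable_cat_map m : measurable_fun setT (@cat_map m).
Proof.
apply/measurable_fun_tnthP => i; case: (split_ordP i) => j ->.
  rewrite (_ : _ \o _ = h1 \o (@tnth m T)^~ j).
    by apply: measurableT_comp => //; exact: measurable_tnth.
  by apply/funext => x /=; rewrite tnth_lshift tnth_map.
rewrite (_ : _ \o _ = h2 \o (@tnth m T)^~ j).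
  by apply: measurableT_comp => //; exact: measurable_tnth.
by apply/funext => x /=; rewrite tnth_rshift tnth_map.
Qed.

Let powerP_cat_map m A : measurable A ->
  powerP Q m (@cat_map m @^-1` A) = powerP P (m + m) A.
Proof.
move=> mA; rewrite -(lawE _ (@measurable_cat_map m)).
apply: powerP_unique => // {mA}A mA.
rewrite lawE (_ : _ @^-1` _ = box (fun i => h1 @^-1` A (lshift m i) `&`
                                          h2 @^-1` A (rshift m i))); last first.
  apply/seteqP; split=> x /= H i.
    have := H (lshift m i); have := H (rshift m i).
    by rewrite tnth_lshift tnth_rshift !tnth_map.
  by case: (split_ordP i) => j ->;
    rewrite ?tnth_lshift ?tnth_rshift tnth_map; case: (H j).
rewrite [LHS]powerP_boxE; last first.
  by move=> i; apply: measurableI; rewrite -[X in measurable X]setTI;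
    [exact: mh1|exact: mh2].
rewrite big_split_ord/= -big_split/=.
by apply: eq_bigr => i _; rewrite h12.
Qed.

Lemma powerP_indep_images m (A B : set (m.-tuple T')) :
  measurable A -> measurable B ->
  powerP Q m [set z | A (map_tuple h1 z) /\ B (map_tuple h2 z)] =
  (powerP P m A * powerP P m B)%E.
Proof.
move=> mA mB.
have E h (z : m.-tuple T) (x : (m + m).-tuple T') (s : 'I_m -> 'I_(m + m)) :
    (forall i, tnth x (s i) = h (tnth z i)) -> reindex s x = map_tuple h z.
  by move=> H; apply/eq_from_tnth => i; rewrite tnth_mktuple tnth_map.
have El (z : m.-tuple T) : reindex (@lshift m m) (cat_map z) = map_tuple h1 z.
  by apply: E => i; rewrite tnth_lshift tnth_map.
have Er (z : m.-tuple T) : reindex (@rshift m m) (cat_map z) = map_tuple h2 z.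
  by apply: E => i; rewrite tnth_rshift tnth_map.
have ml C (s : 'I_m -> 'I_(m + m)) : measurable C ->
    measurable (@reindex _ T' _ _ s @^-1` C).
  by move=> mC; rewrite -[X in measurable X]setTI; exact: measurable_reindex.
transitivity (powerP P (m + m)
    (reindex (@lshift m m) @^-1` A `&` reindex (@rshift m m) @^-1` B)).
  rewrite -powerP_cat_map; last by apply: measurableI; exact: ml.
  by congr (_ _); apply/seteqP; split=> z /=; rewrite El Er.
rewrite (@powerP_indep _ _ _ _ _ (fun i : 'I_(m + m) => (i < m)%N)).
- by rewrite !powerP_reindex//; [exact: rshift_inj|exact: lshift_inj].
- exact: ml.
- exact: ml.
- move=> x y H /=; rewrite (_ : reindex _ x = reindex (@lshift m m) y)//.
  by apply/eq_from_tnth => i; rewrite !tnth_mktuple H//=.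
- move=> x y H /=; rewrite (_ : reindex _ x = reindex (@rshift m m) y)//.
  by apply/eq_from_tnth => i; rewrite !tnth_mktuple H//= -leqNgt leq_addr.
Qed.

End independent_images.

Lemma I01_val_ge0 (R : realType) (x : I01 R) : 0 <= I01_val x.
Proof. by rewrite /I01_val. Qed.

Lemma I01_val_le1 (R : realType) (x : I01 R) : I01_val x <= 1.
Proof. by rewrite /I01_val. Qed.

Section coupling.
Variable R : realType.
Local Notation I := (I01 R).
Local Notation P := (uniform_I01 R).

Local Notation Omega := (I * (I * I))%type.

Definition coupling : probability Omega R := (P \x (P \x P))%E.

(* The third uniform variable decides whether the second copy reuses the first
   variable; the threshold 0 makes the copies independent and 2 makes them equal. *)
Definition second_copy (p : R) (z : Omega) : I :=
  if I01_val z.2.2 < p then z.1 else z.2.1.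

Let measurable_lt p : measurable [set w : I | I01_val w < p].
Proof.
exists `]-oo, p[%classic => //; rewrite setTI.
by apply/seteqP; split=> x /=; rewrite in_itv.
Qed.

Lemma measurable_second_copy p : measurable_fun setT (second_copy p).
Proof.
apply: measurable_fun_ifT => //=.
  apply: measurable_fun_ltr => //.
  apply: measurableT_comp; first exact: measurable_I01_val.
  by apply: measurableT_comp.
by apply: measurableT_comp.
Qed.

Lemma coupling_box B C D : measurable B -> measurable C -> measurable D ->
  coupling (B `*` (C `*` D)) = (P B * (P C * P D))%E.
Proof.
move=> mB mC mD; transitivity (P B * (P \x P)%E (C `*` D))%E.
  by apply: product_measure1E => //; exact: measurableX.
by congr (_ * _)%E; exact: product_measure1E.
Qed.

Lemma first_copy_law B : measurable B -> coupling (fst @^-1` B) = P B.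
Proof.
move=> mB; transitivity (coupling (B `*` (setT `*` setT))).
  by congr (_ _); apply/seteqP; split=> x //= [].
by rewrite coupling_box// !probability_setT !mule1.
Qed.

Lemma second_copy_law p B : measurable B ->
  coupling (second_copy p @^-1` B) = P B.
Proof.
move=> mB; set W := [set w : I | I01_val w < p].
have mW : measurable W by exact: measurable_lt.
transitivity (coupling ((B `*` (setT `*` W)) `|` (setT `*` (B `*` ~` W)))).
  congr (_ _); apply/seteqP; split=> -[u [v w]] /=; rewrite /second_copy/=.
    by case: ifPn => wp Bx; [left|right]; split=> //; split=> //=; exact/negP.
  by case=> -[Bu [Bv Ww]]; [rewrite Ww|move/negP/negbTE: Ww => ->].
have mWC : measurable (~` W) by exact: measurableC.
transitivity (coupling (B `*` (setT `*` W)) +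
              coupling (setT `*` (B `*` ~` W)))%E.
  apply: measureU.
  - by apply: measurableX => //; exact: measurableX.
  - by apply: measurableX => //; exact: measurableX.
  - by apply/seteqP; split=> // -[u [v w]] [[_ [_ Ww]] [_ [_ /(_ Ww)]]].
rewrite !coupling_box// probability_setT !mul1e probability_setC// -ge0_muleDr.
- by rewrite addeC subeK ?mule1// fin_num_measure.
- exact: measure_ge0.
- by rewrite sube_ge0 ?fin_num_measure// probability_le1.
Qed.

Definition joint_event m (A : set (m.-tuple I)) p : set (m.-tuple Omega) :=
  [set z | A (map_tuple fst z) /\ A (map_tuple (second_copy p) z)].

Lemma measurable_joint_event m (A : set (m.-tuple I)) p :
  measurable A -> measurable (joint_event A p).
Proof.
move=> mA; apply: measurableI; rewrite -[X in measurable X]setTI.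
  by apply: measurable_map_tuple.
by apply: measurable_map_tuple => //; exact: measurable_second_copy.
Qed.

Definition joint_prob m (A : set (m.-tuple I)) p : R :=
  fine (powerP coupling m (joint_event A p)).

Lemma joint_prob0 m (A : set (m.-tuple I)) : measurable A ->
  joint_prob A 0 = fine (powerP P m A) ^+ 2.
Proof.
move=> mA; rewrite /joint_prob.
transitivity (fine (powerP P m A * powerP P m A)%E); last first.
  by rewrite fineM ?expr2// fin_num_measure.
congr fine; apply: powerP_indep_images => //; first exact: measurable_second_copy.
move=> B C mB mC; transitivity (coupling (B `*` (C `*` setT))).
  congr (_ _); apply/seteqP; split=> -[u [v w]] /=; rewrite /second_copy/=;
    rewrite ltNge I01_val_ge0/=.
    by case.
  by case=> Bu [].
by rewrite coupling_box// probability_setT mule1.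
Qed.

(** Labels are at most 1 and the test is strict, so threshold 2 makes the copies agree at every
    point; threshold 1 would do so only almost surely. *)
Lemma joint_prob2 m (A : set (m.-tuple I)) : measurable A ->
  joint_prob A 2 = fine (powerP P m A).
Proof.
move=> mA; rewrite /joint_prob; congr fine.
rewrite -(@powerP_map _ _ _ _ _ coupling P fst)//; last exact: first_copy_law.
have E z : second_copy 2 z = z.1.
  by rewrite /second_copy (le_lt_trans (I01_val_le1 _)) ?ltr1n.
congr (_ _); apply/seteqP; split=> z /=; first by case.
rewrite /joint_event/= (_ : map_tuple (second_copy 2) z = map_tuple fst z)//.
by apply/eq_from_tnth => i; rewrite !tnth_map E.
Qed.

(** Thresholds p and q produce the same second copy unless some third variable falls in [p, q). Each
    does so with probability at most q - p, and a union bound over the m coordinates concludes. *)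
Lemma joint_prob_lipschitz m (A : set (m.-tuple I)) p q : measurable A ->
  p <= q -> `|joint_prob A p - joint_prob A q| <= m%:R * (q - p).
Proof.
move=> mA pq.
pose W : set I := [set w | p <= I01_val w < q].
have mW : measurable W.
  exists `[p, q[%classic => //; rewrite setTI.
  by apply/seteqP; split=> x /=; rewrite in_itv.
have PW : (P W <= (q - p)%:E)%E.
  have -> : W = @I01_val R @^-1` `[p, q[.
    by apply/seteqP; split=> x /=; rewrite in_itv.
  rewrite uniform_I01E//; apply: (@le_trans _ _ (lebesgue_measure `[p, q[%classic)).
    by apply: le_measure; rewrite ?inE//; apply: measurableI.
  by rewrite lebesgue_measure_itv/= lte_fin; case: ltP => // _; rewrite lee_fin subr_ge0.
pose D i : set (m.-tuple Omega) := [set z | W (tnth z i).2.2].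
have mtnth (i : 'I_m) := @measurable_tnth _ Omega m i.
have mD i : measurable (D i).
  rewrite (_ : D i = (fun z : m.-tuple Omega => (tnth z i).2.2) @^-1` W)//.
  rewrite -[X in measurable X]setTI.
  have : measurable_fun setT (fun z : m.-tuple Omega => (tnth z i).2.2).
    by do 2 apply: measurableT_comp => //.
  by apply.
have PD i : (powerP coupling m (D i) <= (q - p)%:E)%E.
  apply: le_trans PW; rewrite le_eqVlt; apply/orP; left; apply/eqP.
  pose B (j : 'I_m) : set Omega := if j == i then setT `*` (setT `*` W) else setT.
  transitivity (powerP coupling m (box B)).
    congr (_ _); apply/seteqP; split=> z /=.
      by move=> Wz j; rewrite /B; case: eqP => // ->.
    by move/(_ i); rewrite /B eqxx => -[_ []].
  rewrite powerP_boxE; last first.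
    by move=> j; rewrite /B; case: ifP => // _; do 2 apply: measurableX => //.
  rewrite (bigD1 i)//= big1 ?mule1.
    by rewrite /B eqxx coupling_box// probability_setT !mul1e.
  by move=> j /negbTE ji; rewrite /B ji probability_setT.
pose U := \big[setU/set0]_(i < m) D i.
have [mU PU] : measurable U /\ (powerP coupling m U <= (m%:R * (q - p))%:E)%E.
  suff [mU PU] : measurable U /\
      (powerP coupling m U <= \sum_(i < m) powerP coupling m (D i))%E.
    split=> //; apply: le_trans PU _.
    apply: (@le_trans _ _ (\sum_(i < m) (q - p)%:E)%E); first exact: lee_sum.
    by rewrite sumEFin sumr_const card_ord mulr_natl.
  apply: (big_rec2 (fun (y : \bar R) X => measurable X /\
      (powerP coupling m X <= y)%E)) => [|i y X _ [mX Xy]].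
    by rewrite measure0.
  split; first exact: measurableU.
  by apply: (le_trans (measureU2 _ (mD i) mX)); exact: leeD.
have sub a b : (a, b) = (p, q) \/ (a, b) = (q, p) ->
    joint_event A a `<=` joint_event A b `|` U.
  move=> ab z [Az1 Az2].
  have [Uz|nU] := pselect (U z); first by right.
  left; split=> //; rewrite (_ : map_tuple _ z = map_tuple (second_copy a) z)//.
  apply/eq_from_tnth => i; rewrite !tnth_map /second_copy.
  have nW : ~ W (tnth z i).2.2.
    by move=> Wz; apply: nU; rewrite /U -bigcup_seq; exists i; rewrite //= mem_index_enum.
  move: nW; rewrite /W/=; set w := I01_val _ => nW.
  suff -> : (w < a) = (w < b) by [].
  have {nW} : ~~ (p <= w < q) by exact/negP.
  by case: ab => -[-> ->]; case: (leP p w) => pw; case: (ltP w q) => wq //; lra.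
have le a b : (a, b) = (p, q) \/ (a, b) = (q, p) ->
    joint_prob A a <= joint_prob A b + m%:R * (q - p).
  move=> ab; rewrite -lee_fin EFinD.
  have mE c := measurable_joint_event c mA.
  rewrite /joint_prob !fineK ?fin_num_measure//.
  apply: (@le_trans _ _ (powerP coupling m (joint_event A b `|` U))).
    by apply: le_measure; rewrite ?inE//; [exact: measurableU|exact: sub].
  apply: (@le_trans _ _ (powerP coupling m (joint_event A b) + powerP coupling m U)%E).
    exact: measureU2.
  exact: leeD.
have := le p q (or_introl erefl); have := le q p (or_intror erefl).
by move=> *; rewrite ler_norml; lra.
Qed.

End coupling.

(** * Concentration *)

Lemma joint_prob_ivt (R : realType) m (A : set (m.-tuple (I01 R))) (gamma : R) :
  measurable A ->
  fine (powerP (uniform_I01 R) m A) ^+ 2 <= gamma <=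
    fine (powerP (uniform_I01 R) m A) ->
  exists p, joint_prob A p = gamma.
Proof.
move=> mA g; have cont : continuous (joint_prob A).
  move=> x; apply/cvgrPdist_le => e e0; near=> y.
  have H a b : a <= b -> b - a <= e / m.+1%:R ->
      `|joint_prob A a - joint_prob A b| <= e.
    move=> ab bae; apply: (le_trans (joint_prob_lipschitz mA ab)).
    apply: (@le_trans _ _ (m.+1%:R * (e / m.+1%:R))).
      by apply: ler_pM => //; rewrite ?subr_ge0// ler_nat.
    by rewrite mulrCA divff ?mulr1// pnatr_eq0.
  have : `|x - y| <= e / m.+1%:R.
    near: y; apply: (@cvgr_dist_le _ _ _ _ _ id) => //.
    by rewrite divr_gt0// ltr0n.
  have [xy|/ltW yx] := leP x y.
    by rewrite ler0_norm ?subr_le0// opprB; exact: H.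
  by rewrite ger0_norm ?subr_ge0// => ?; rewrite distrC; exact: H.
have [|p _ <-] := @IVT _ (joint_prob A) 0 2 gamma (ler0n _ _)
  (continuous_subspaceT cont); last by exists p.
rewrite joint_prob0// joint_prob2// (min_idPl _) ?(max_idPr _)//.
all: by case/andP: g; exact: le_trans.
Unshelve. all: by end_near. Qed.

Section concentration.
Context d (T : measurableType d) (R : realType) (P : probability T R).

(** Turns probabilities of events seen through a finite-valued map into finite sums, so that the
    variance below is computed by algebra rather than integration. *)
Lemma finite_partition (K : finType) (S : T -> K) (Phi : pred K) :
  (forall s, measurable (S @^-1` [set s])) ->
  measurable [set z | Phi (S z)] /\
  fine (P [set z | Phi (S z)]) = \sum_(s | Phi s) fine (P (S @^-1` [set s])).
Proof.
move=> mS; have H (l : seq K) : uniq l ->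
    measurable [set z | S z \in l] /\
    P [set z | S z \in l] = (\sum_(s <- l) P (S @^-1` [set s]))%E.
  elim: l => [_|s l IH /= /andP[sl /IH[ml Pl]]].
    have -> : [set z | S z \in [::]] = set0 by apply/seteqP; split.
    by rewrite big_nil measure0; split.
  rewrite (_ : mkset _ = S @^-1` [set s] `|` [set z | S z \in l]); last first.
    apply/seteqP; split=> z /=; rewrite inE.
      by move=> /orP[/eqP|]; [left|right].
    by move=> [->|->]; rewrite ?eqxx ?orbT.
  split; first exact: measurableU.
  rewrite big_cons -Pl; apply: measureU => //.
  by apply/seteqP; split=> // z /= [->]; rewrite (negbTE sl).
have := H _ (enum_uniq Phi).
rewrite (_ : mkset _ = [set z | Phi (S z)]); last first.
  by apply/seteqP; split=> z /=; rewrite mem_enum.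
move=> [mPhi ->]; split=> //.
rewrite -sum_fine; last by move=> s _; rewrite fin_num_measure.
by rewrite big_enum.
Qed.

Lemma measurable_occurrences n (E : 'I_n -> set T) (s : {set 'I_n}) :
  (forall u, measurable (E u)) ->
  measurable ((fun z => [set u | `[< E u z >]]%SET) @^-1` [set s]).
Proof.
move=> mE; rewrite (_ : _ @^-1` _ = \bigcap_(u in [set: 'I_n])
    (if u \in s then E u else ~` E u)).
  apply: fin_bigcap_measurable => // u _; case: ifP => _ //.
  exact: measurableC.
apply/seteqP; split=> z /=.
  by move=> <- u _; rewrite inE; case: asboolP.
move=> H; apply/setP => u; rewrite inE; have := H u I.
by case: ifP => _ Hu; apply/asboolP.
Qed.

Lemma count_concentration n (E : 'I_n -> set T) (D : {set 'I_n * 'I_n}) (t : R) :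
  (forall u, measurable (E u)) ->
  (forall u v, (u, v) \notin D -> P (E u `&` E v) = (P (E u) * P (E v))%E) ->
  0 < t ->
  fine (P [set z | t <= `|#|[set u | `[< E u z >]]%SET|%:R
                          - \sum_u fine (P (E u))| ]) <= #|D|%:R / t ^+ 2.
Proof.
move=> mE indep t0.
pose S z : {set 'I_n} := [set u | `[< E u z >]]%SET.
have SE u z : (u \in S z) = `[< E u z >] by rewrite inE.
have mS s : measurable (S @^-1` [set s]) by exact: measurable_occurrences.
pose w s := fine (P (S @^-1` [set s])).
have w0 s : 0 <= w s by rewrite fine_ge0.
have PE Phi := (finite_partition Phi mS).2.
pose p u := fine (P (E u)).
have pE u : p u = \sum_(s : {set 'I_n}) w s * (u \in s)%:R.
  rewrite /p (_ : E u = [set z | u \in S z]).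
    rewrite (PE (fun s => u \in s)) big_mkcond/=; apply: eq_bigr => s _.
    by case: ifP; rewrite ?mulr1 ?mulr0.
  by apply/seteqP; split=> z /=; rewrite SE => /asboolP.
have puvE u v : fine (P (E u `&` E v)) =
    \sum_(s : {set 'I_n}) w s * ((u \in s)%:R * (v \in s)%:R).
  rewrite (_ : E u `&` E v = [set z | (u \in S z) && (v \in S z)]).
    rewrite (PE (fun s => (u \in s) && (v \in s))) big_mkcond/=.
    apply: eq_bigr => s _.
    by case: (u \in s); case: (v \in s); rewrite ?mulr1 ?mulr0.
  apply/seteqP; split=> z /=; rewrite !SE.
    by move=> [Eu Ev]; apply/andP; split; apply/asboolP.
  by move=> /andP[/asboolP ? /asboolP ?].
have w1 : \sum_(s : {set 'I_n}) w s = 1.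
  have := PE predT; rewrite /= => <-.
  by rewrite (_ : mkset _ = setT) ?probability_setT//; exact/seteqP.
have p01 u : 0 <= p u <= 1.
  rewrite /p fine_ge0//= -lee_fin fineK ?fin_num_measure//.
  exact: probability_le1.
pose m := \sum_u p u.
(* Expanding the square gives one covariance per ordered pair: zero off D by independence, at most 1
   on D. *)
have var : \sum_(s : {set 'I_n}) w s * (#|s|%:R - m) ^+ 2 <= #|D|%:R.
  have sqE (s : {set 'I_n}) : (#|s|%:R - m) ^+ 2 =
      \sum_u \sum_v ((u \in s)%:R - p u) * ((v \in s)%:R - p v).
    have -> : #|s|%:R = \sum_u (u \in s)%:R :> R.
      by rewrite -sum1_card natr_sum big_mkcond/=; apply: eq_bigr => u _; case: ifP.
    rewrite -sumrB expr2 big_distrl/=; apply: eq_bigr => u _.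
    by rewrite big_distrr.
  under eq_bigr do rewrite sqE big_distrr/=.
  rewrite exchange_big/=.
  under eq_bigr do (under eq_bigr do rewrite big_distrr/=; rewrite exchange_big/=).
  rewrite pair_big/= -sum1_card natr_sum [leRHS]big_mkcond/=.
  apply: ler_sum => -[u v] _ /=.
  have -> : \sum_(s : {set 'I_n}) w s * (((u \in s)%:R - p u) * ((v \in s)%:R - p v)) =
      fine (P (E u `&` E v)) - p u * p v.
    have X (a b c e f : R) : a * ((b - e) * (c - f)) =
        a * (b * c) - f * (a * b) - e * (a * c) + (e * f) * a by ring.
    under eq_bigr do rewrite X.
    rewrite big_split/= !sumrB -!big_distrr/= -puvE -!pE w1; ring.
  case: ifPn => [_|/indep ->]; last by rewrite fineM ?fin_num_measure// subrr.
  have [/andP[pu0 _] /andP[pv0 _]] := (p01 u, p01 v).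
  have : fine (P (E u `&` E v)) <= 1.
    rewrite -lee_fin fineK ?fin_num_measure//; last exact: measurableI.
    by apply: probability_le1; exact: measurableI.
  by have := mulr_ge0 pu0 pv0; lra.
rewrite ler_pdivlMr ?exprn_gt0//; apply: le_trans var.
rewrite (PE (fun s => t <= `|#|s|%:R - m|)) big_distrl/=.
rewrite [leRHS](bigID (fun s : {set 'I_n} => t <= `|#|s|%:R - m|))/=.
rewrite -[leLHS]addr0 lerD//; last by apply: sumr_ge0 => s _; rewrite mulr_ge0 ?sqr_ge0.
apply: ler_sum => s ts; apply: ler_wpM2l; first exact: w0.
by rewrite -[leRHS]real_normK ?num_real// ler_sqr ?nnegrE ?(ltW t0).
Qed.

End concentration.

(** * Local functions on random regular graphs *)

Section local_functions.
Variables (R : realType) (d r : nat) (f : decision_fun R).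
Hypotheses (d_gt0 : (0 < d)%N) (mf : measurable_decision f) (locf : local_fun r f).
Local Notation U := (I01 R).
Local Notation m := (tree_size d r).

Definition selected n (G : sgraph n) (u : 'I_n) : set (n.-tuple U) :=
  [set x | f u G x].

Lemma measurable_selected n (G : sgraph n) u : measurable (selected G u).
Proof.
have := @mf n n u G (leqnn n) measurableT [set true] I.
by rewrite setTI.
Qed.

Definition tree_selected : set (m.-tuple U) := selected (regular_tree d r) ord0.

Lemma alphaE : alpha d r f = fine (powerP (uniform_I01 R) m tree_selected).
Proof.
rewrite /alpha -[in RHS](expectation_indic _ (measurable_selected _ _)).
congr (fine (expectation _ _)); apply/funext => x /=.
rewrite indicE; congr (_%:R); apply/esym.
by case: (boolP (f _ _ x)) => fx; [rewrite mem_set|rewrite memNset//; exact/negP].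
Qed.

Lemma selected_local n (G : sgraph n) u (x y : n.-tuple U) :
  (forall v, v \in dball (adj G) r u -> tnth x v = tnth y v) ->
  selected G u x -> selected G u y.
Proof.
move=> xy; rewrite /selected/= (@locf _ _ _ _ (leqnn n) (leqnn n) G G u u id x y)//.
  by split=> //; split=> // v uv; exists v.
move=> v /ballP /xy; rewrite (_ : widen_ord _ v = v)//; exact/val_inj.
Qed.

Lemma selected_tree n (G : sgraph n) u : regular d G -> u \notin bad_vertices G r ->
  exists2 phi : 'I_m -> 'I_n, injective phi &
    forall x, selected G u x <-> tree_selected (reindex phi x).
Proof.
move=> reg good.
have [|phi inj iso] := @regular_tree_local_iso d r n G u d_gt0 reg.
  move=> x y xu; apply: contra good => xy; rewrite inE; apply/existsP.
  by exists (x, y); rewrite xu.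
exists phi => // x; rewrite /tree_selected /selected/=.
rewrite (@locf _ _ _ _ (leqnn m) (leqnn n) _ G ord0 u phi (reindex phi x) x)//.
move=> v _; rewrite tnth_mktuple; congr (tnth _ _); apply/val_inj => /=.
by congr (val (phi _)); exact/val_inj.
Qed.

Variables (n : nat) (G : sgraph n) (p : R).
Hypothesis reg : regular d G.
Local Notation Q := (powerP (coupling R) n).
Let E u := joint_event (selected G u) p.

(** Around a good vertex the event reads the labels only through an injective reindexing by the
    tree, which preserves the product law. *)
Lemma joint_selected_prob u : u \notin bad_vertices G r ->
  fine (Q (E u)) = joint_prob tree_selected p.
Proof.
move=> /(selected_tree reg)[phi inj H].
rewrite /joint_prob -(powerP_reindex _ inj); last first.
  by apply: measurable_joint_event; exact: measurable_selected.
have mapE (h : U * (U * U) -> U) z :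
    reindex phi (map_tuple h z) = map_tuple h (reindex phi z).
  by apply/eq_from_tnth => i; rewrite !(tnth_mktuple, tnth_map).
congr (fine (_ _)); apply/seteqP; split=> z [z1 z2]; split.
- by rewrite -mapE; apply/H.
- by rewrite -mapE; apply/H.
- by apply/H; rewrite mapE.
- by apply/H; rewrite mapE.
Qed.

Lemma joint_selected_indep u v : v \notin dball (adj G) (r + r) u ->
  Q (E u `&` E v) = (Q (E u) * Q (E v))%E.
Proof.
move=> uv; have mE w : measurable (E w).
  by apply: measurable_joint_event; exact: measurable_selected.
have dep w (x y : n.-tuple (U * (U * U))) :
    (forall i, i \in dball (adj G) r w -> tnth x i = tnth y i) -> E w x -> E w y.
  by move=> xy [E1 E2]; split; [apply: selected_local E1|apply: selected_local E2];
    move=> i iw; rewrite !tnth_map xy.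
apply: (@powerP_indep _ _ _ _ _ (fun i => i \in dball (adj G) r u)) => //.
- by move=> x y; exact: dep.
- move=> x y xy; apply: dep => i iv; apply: xy.
  apply: contra uv => iu; apply: dball_trans iu _.
  by rewrite dball_sym//; exact: adj_sym.
Qed.

Lemma joint_selected_mean :
  `|\sum_u fine (Q (E u)) - joint_prob tree_selected p * n%:R| <=
  #|bad_vertices G r|%:R.
Proof.
have -> : joint_prob tree_selected p * n%:R =
    \sum_(u : 'I_n) joint_prob tree_selected p.
  by rewrite sumr_const card_ord mulr_natr.
rewrite -sumrB; apply: le_trans (ler_norm_sum _ _ _) _.
rewrite -sum1_card natr_sum [leRHS]big_mkcond/=; apply: ler_sum => u _.
case: ifPn => [_|/joint_selected_prob ->]; last by rewrite subrr normr0.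
have P01 k (P : probability (k.-tuple (U * (U * U))) R) X : measurable X ->
    0 <= fine (P X) <= 1.
  move=> mX; rewrite fine_ge0//= -lee_fin fineK ?fin_num_measure//.
  exact: probability_le1.
have mE k (A : set (k.-tuple U)) : measurable A -> measurable (joint_event A p).
  exact: measurable_joint_event.
have := P01 _ (powerP (coupling R) n) _ (mE _ _ (measurable_selected G u)).
have := P01 _ (powerP (coupling R) m) _
  (mE _ _ (measurable_selected (regular_tree d r) ord0)).
rewrite -/tree_selected -/(joint_prob _ _) -/(E u) ler_norml.
by move=> /andP[? ?] /andP[? ?]; apply/andP; split; lra.
Qed.

Lemma joint_selected_concentration t : 0 < t ->
  fine (Q [set z | t <= `|#|[set u | `[< E u z >]]%SET|%:R
                          - \sum_u fine (Q (E u))|]) <=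
  (n * d.+1 ^ (r + r))%N%:R / t ^+ 2.
Proof.
move=> t0.
apply: le_trans (@count_concentration _ _ _ _ _ _
  [set q : 'I_n * 'I_n | q.2 \in dball (adj G) (r + r) q.1]%SET _ _ _ t0) _.
- by move=> u; by apply: measurable_joint_event; exact: measurable_selected.
- by move=> u v; rewrite inE => /joint_selected_indep.
rewrite ler_wpM2r ?invr_ge0 ?sqr_ge0// ler_nat -sum1dep_card.
rewrite -(pair_big_dep predT (fun u => mem (dball (adj G) (r + r) u)) (fun _ _ => 1%N)).
rewrite -[in leqRHS](card_ord n) -sum_nat_const leq_sum// => u _.
by rewrite sum1_card card_dball_regular.
Qed.

End local_functions.

(** * Integration over the random graph *)

Section product_of_finite.
Context d (T : measurableType d) (R : realType) (n : nat).
Variables (P : probability (sgraph n) R) (Q : probability T R).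

(** Measurability is asked section by section, the graph space being discrete. A section is bounded
    by 1 when its graph is in B and by c otherwise. *)
Lemma product_measure_sgraph_le (W : set (sgraph n * T)) (B : {set sgraph n}) c :
  0 <= c -> (forall G, measurable [set x | W (G, x)]) ->
  (forall G, G \notin B -> (Q [set x | W (G, x)] <= c%:E)%E) ->
  ((P \x Q) W <= P [set` B] + c%:E)%E.
Proof.
move=> c0 mW H; rewrite /product_measure1.
have m1B : measurable_fun setT (fun G => (\1_[set` B] G)%:E : \bar R) by [].
apply: (@le_trans _ _ (\int[P]_G ((\1_[set` B] G)%:E + c%:E))%E).
  apply: ge0_le_integral => //.
  - move=> G _ /=; rewrite xsectionE; have [GB|GB] := boolP (G \in B).
      rewrite indicE mem_set//; apply: (le_trans (probability_le1 _ (mW G))).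
      by rewrite leeDl// lee_fin.
    by rewrite indicE memNset ?add0e; [exact: H|exact/negP].
rewrite ge0_integralD//.
rewrite integral_indic// setIT leeD2l//.
have -> : (\int[P]__ c%:E = c%:E * P setT)%E by exact: integral_cst.
by rewrite probability_setT mule1.
Qed.

End product_of_finite.

Theorem theorem2p7 (R : realType) (d r : nat) (hd : (0 < d)%N) (hr : (0 < r)%N)
    (f : decision_fun R) (mf : measurable_decision f)
    (indf : independence_fun f) (locf : local_fun r f)
    (gamma eps : R) (hgamma : alpha d r f ^+ 2 <= gamma <= alpha d r f)
    (heps : 0 < eps) :
  exists n0 : nat, forall n : nat, (n0 <= n)%N -> ~~ odd (n * d) ->
  exists mu : probability (n.-tuple (I01 R) * n.-tuple (I01 R))%type R,
    [/\ forall A, measurable A -> mu (fst @^-1` A) = uniform_cube R n A,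
        forall A, measurable A -> mu (snd @^-1` A) = uniform_cube R n A
      & ((random_regular_graph R d n \x mu)
          [set w : sgraph n * (n.-tuple (I01 R) * n.-tuple (I01 R)) |
            (#|indep_set f w.1 w.2.1 :&: indep_set f w.1 w.2.2|%:R
              \notin `[(gamma - eps) * n%:R, (gamma + eps) * n%:R])%R]
        <= eps%:E)%E].
Proof.
have mT : measurable (@tree_selected R d r f) by exact: measurable_selected.
have [p pgamma] : exists p, joint_prob (@tree_selected R d r f) p = gamma.
  by apply: joint_prob_ivt => //; rewrite -alphaE.
(* The bound 1/K <= eps/2 serves twice: for the probability of a bad graph, and for the proportion
   of bad vertices in a good one. *)
pose K := Num.bound (2 / eps).
have eps2 : 0 <= 2 / eps by rewrite divr_ge0// ltW.
have Keps : 2 / eps < K%:R by exact: archi_boundP.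
have K0 : 0 < K%:R :> R by exact: le_lt_trans Keps.
have Kinv : K%:R^-1 <= eps / 2.
  by rewrite -[eps / 2]invrK invf_div lef_pV2 ?posrE ?divr_gt0// ltW.
have [n1 Hn1] := few_bad_vertices r K hd.
pose C := (d.+1 ^ (r + r))%N.
(* Chebyshev with deviation [eps / 2 * n] gives 4C / (eps^2 n), which is at most eps/2 once n >= 8C
   / eps^3. *)
pose b := C%:R * 8 / eps ^+ 3.
have b0 : 0 <= b by rewrite divr_ge0 ?exprn_ge0 ?mulr_ge0// ltW.
exists (n1 + d.+1 + Num.bound b)%N => n nbig nd.
have n_gt0 : 0 < n%:R :> R by rewrite ltr0n; lia.
have bn : b <= n%:R.
  apply: le_trans (ltW (archi_boundP b0)) _; rewrite ler_nat; lia.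
have mpair : measurable_fun setT (fun z : n.-tuple (I01 R * (I01 R * I01 R)) =>
    (map_tuple fst z, map_tuple (second_copy p) z)).
  apply: measurable_fun_pair; apply: measurable_map_tuple => //.
  exact: measurable_second_copy.
exists (law (powerP (coupling R) n) mpair); split=> [A mA|A mA|].
- rewrite lawE -(powerP_map _ (@first_copy_law R) mA)//.
- rewrite lawE -(powerP_map _ (second_copy_law p) mA)//; exact: measurable_second_copy.
have mW (G : sgraph n) : measurable [set xy : n.-tuple (I01 R) * n.-tuple (I01 R) |
    (#|indep_set f G xy.1 :&: indep_set f G xy.2|%:R
      \notin `[(gamma - eps) * n%:R, (gamma + eps) * n%:R])%R].
  pose E u := [set xy : n.-tuple (I01 R) * n.-tuple (I01 R) |
    selected f G u xy.1 /\ selected f G u xy.2].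
  have mE u : measurable (E u).
    apply: measurableI; rewrite -[X in measurable X]setTI.
      by apply: measurable_fst => //; exact: measurable_selected.
    by apply: measurable_snd => //; exact: measurable_selected.
  pose Phi (s : {set 'I_n}) : bool := (#|s|%:R
    \notin `[(gamma - eps) * n%:R, (gamma + eps) * n%:R]).
  pose S xy : {set 'I_n} := [set u | `[< E u xy >]]%SET.
  rewrite (_ : mkset _ = [set xy | Phi (S xy)]).
    apply: (@finite_partition _ _ _ (law (powerP (coupling R) n) mpair) _ S Phi _).1.
    by move=> s; exact: measurable_occurrences.
  apply/funext => xy /=; rewrite /Phi (_ : S xy = indep_set f G xy.1 :&: indep_set f G xy.2)//.
  by apply/setP => u; rewrite !inE; apply/asboolP/andP => -[? ?]; split.
(* Nonregular graphs are included, at no cost since they carry no mass; outside B regularity is then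
   available. *)
pose B := [set G : sgraph n | (~~ regular d G) || (n < K * #|bad_vertices G r|)%N]%SET.
apply: (@le_trans _ _ (random_regular_graph R d n [set` B] + (eps / 2)%:E)%E).
  apply: product_measure_sgraph_le.
  - by rewrite divr_ge0// ltW.
  - by move=> G; exact: mW.
  move=> G; rewrite inE negb_or negbK -leqNgt => /andP[reg good].
  pose E u := joint_event (selected f G u) p.
  pose M := \sum_u fine (powerP (coupling R) n (E u)).
  (* Half of the tolerance absorbs the shift of the mean, the other half the fluctuation around
     it. *)
  pose t := eps / 2 * n%:R.
  have t0 : 0 < t by rewrite mulr_gt0 ?divr_gt0.
  have meanM : `|M - gamma * n%:R| <= t.
    rewrite -pgamma; apply: le_trans (joint_selected_mean hd mf locf p reg) _.
    apply: (@le_trans _ _ (K%:R^-1 * n%:R)); last by rewrite ler_wpM2r.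
    by rewrite ler_pdivlMl// -natrM ler_nat.
  have mE u : measurable (E u) by apply: measurable_joint_event; exact: measurable_selected.
  have mcount (Phi : pred {set 'I_n}) :
      measurable [set z | Phi [set u | `[< E u z >]]%SET].
    apply: (finite_partition (powerP (coupling R) n) Phi _).1 => s.
    exact: measurable_occurrences.
  rewrite lawE; pose Z := [set z | t <= `|#|[set u | `[< E u z >]]%SET|%:R - M|].
  apply: (@le_trans _ _ (powerP (coupling R) n Z)).
    apply: le_measure; rewrite ?inE.
    - by rewrite -[X in measurable X]setTI; apply: mpair => //; exact: mW.
    - exact: (mcount (fun s => t <= `|#|s|%:R - M|)).
    move=> z /=; rewrite (_ : indep_set _ _ _ :&: _ = [set u | `[< E u z >]]%SET).
      rewrite in_itv/= /Z/= => out; rewrite leNgt; apply: contra out.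
      move: meanM; rewrite ler_norml ltr_norml /t => /andP[? ?] /andP[? ?].
      by apply/andP; split; lra.
    apply/setP => u; rewrite !inE.
    by apply/andP/asboolP => -[? ?]; split.
  rewrite -[powerP _ _ _]fineK ?fin_num_measure//; last first.
    exact: (mcount (fun s => t <= `|#|s|%:R - M|)).
  have conc := joint_selected_concentration mf locf p reg t0.
  rewrite lee_fin. apply: (le_trans conc).
  rewrite ler_pdivrMr ?exprn_gt0// natrM /t -/C.
  have : C%:R * 8 <= n%:R * eps ^+ 3 by rewrite -ler_pdivrMr ?exprn_gt0.
  rewrite -(ler_pM2l n_gt0) => Cn.
  have -> : eps / 2 * (eps / 2 * n%:R) ^+ 2 = n%:R * (n%:R * eps ^+ 3) / 8 by field.
  lra.
have -> : eps%:E = ((eps / 2)%:E + (eps / 2)%:E)%E :> \bar R.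
  by rewrite -EFinD -splitr.
rewrite leeD2r//; rewrite random_regular_graphE; last by apply: exists_regular => //; lia.
rewrite lee_fin; apply: le_trans Kinv.
have [G0 regG0] := @exists_regular d n ltac:(lia) nd.
have reg_gt0 : (0 < #|[set G : sgraph n | regular d G]%SET|)%N.
  by apply/card_gt0P; exists G0; rewrite inE.
rewrite ler_pdivrMr ?ltr0n// -(ler_pM2r K0) mulrAC mulVf ?gt_eqF// mul1r.
rewrite -natrM ler_nat; apply: leq_trans (Hn1 n _); last lia.
rewrite leq_mul2r; apply/orP; right; apply/subset_leq_card/fintype.subsetP => G.
by rewrite !inE => /andP[/orP[/negP //|-> ->]].
Qed.
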